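(* Let $n\ge 5k$, let $Z$ be a discrete Gibbs measure random variable on $\{0,1,\dots,N\}$ with parameters $w,U,\beta$ satisfying $e^{U(m+1)-U(m)}=a+bm$, and suppose ${\mathbb E}(Z)={\mathbb E}\big(S_{k_1,k_2}^n\big)$. Put $\varphi=\mathrm{Var}(Z)-\mathrm{Var}\big(S_{k_1,k_2}^n\big)$. Then $$d_{TV}\left(Z,S_{k_1,k_2}^n\right)\le\|\Delta g\|\left\{2(2+qp)a(p)^2\Big(|1-wb|\,h_1(n,k,p)\,a(p)+|wb|\,h_2(n,k,p)\Big)+|\varphi(1-wb)|\right\},$$ where $g$ is the solution of the Stein equation for $Z$ and $\|\Delta g\|$ is understood as the supremum of $\|\Delta g_f\|$ over all test functions $f=\mathbf 1(A)$, $A\subseteq{\mathbb Z}$.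
   Context: Runs. Fix integers $k_1,k_2\ge1$ and put $k=k_1+k_2$. Let $\eta_1,\dots,\eta_n$ be independent Bernoulli trials with ${\mathbb P}(\eta_i=1)=p=1-q=1-{\mathbb P}(\eta_i=0)$, $0<p<1$, and set $\eta_0=1$. For $1\le l\le n-k$ let $${\mathbb I}_l=\eta_{l-1}\Big[\prod_{i=1}^{k_1}(1-\eta_{l+i-1})\prod_{j=1}^{k_2}\eta_{l+k_1+j-1}\Big](1-\eta_{l+k}),\qquad S_{k_1,k_2}^n=\sum_{l=1}^{n-k}{\mathbb I}_l .$$ Write $a(p)=q^{k_1}p^{k_2}$ (not to be confused with the constant $a$ below). Discrete Gibbs measure. $Z$ has PMF ${\mathbb P}(Z=m)=\frac1\beta\frac{e^{U(m)}w^m}{m!}$ for $m\in\mathcal S=\{0,1,\dots,N\}$ ($N$ may be $\infty$), where $w>0$, $U:\mathcal S\to{\mathbb R}$ and $\beta=\sum_{m\in\mathcal S}e^{U(m)}w^m/m!$. It is assumed that $e^{U(m+1)-U(m)}=a+bm$ for constants $a,b\in{\mathbb R}$. For such $Z$ the paper uses (from $G'(t)=\frac{wa}{1-wbt}G(t)$, $G$ the probability generating function of $Z$) ${\mathbb E}(Z)=\frac{wa}{1-wb}$ and $\mathrm{Var}(Z)=\frac{wa}{(1-wb)^2}$. Stein equation and distance. The Stein operator of $Z$ is ${\cal A}_Zg(m)=w\,e^{U(m+1)-U(m)}g(m+1)-m\,g(m)=w(a+bm)g(m+1)-mg(m)$, $m\in\mathcal S$, acting on bounded functions $g$ on ${\mathbb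 Z}$ with $g(0)=0$ and $g(x)=0$ for $x\notin\mathcal S$. For bounded $f$, $g=g_f$ is the solution of ${\cal A}_Zg(m)=f(m)-{\mathbb E}f(Z)$. $\Delta g(j)=g(j+1)-g(j)$, $\|\Delta g\|=\sup_{j\in{\mathbb Z}_+}|\Delta g(j)|$, where ${\mathbb Z}_+=\{0,1,2,\dots\}$. The total variation distance is $d_{TV}(X,Y)=\sup_{A\subseteq{\mathbb Z}}|{\mathbb P}(X\in A)-{\mathbb P}(Y\in A)|$. Constants. $\delta^*=1+q+qp$, $\delta=2+\delta^*(k+2)$, $\delta_1=\delta^*\big(5k+6+\frac{3k^2+11k+10}{2}\delta^*\big)$, $\delta_2=\delta^*\big(3+\frac{4k+7}{2}\delta^*\big)$, $c_{n,k}^{(1)}=(n-2k-2)(k+1)+\frac{(k+1)^{n-k+1}}{(k+2)^{n-k-1}}$, $c_{n,k}^{(2)}=n-3k+k\big(\frac{k+1}{k+2}\big)^{n-2k}$, $c_{n,k}^{(3)}=n-5k+k(nk+6k+4-k^2)\frac{(k+1)^{n-3k-1}}{(k+2)^{n-3k+1}}$, $c_{n,k}^{(4)}=n(3k+1)-(11k^2+9k+2)+(2nk+k^2+7k+2)\big(\frac{k+1}{k+2}\big)^{n-2k}$, $c_{n,k}^{(5)}=n(2k+3)-6k^2-16k-10+(2n+2k+5)\frac{(k+1)^{n-k}}{(k+2)^{n-k-1}}$, $$h_1(n,k,p)=(n-k)(4+\delta_1)+\delta_2c_{n,k}^{(1)}+\delta c_{n,k}^{(2)}+c_{n,k}^{(3)}+\delta^*c_{n,k}^{(4)}+\frac{{\delta^*}^2}{2}c_{n,k}^{(5)},$$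 $$h_2(n,k,p)=(n-k)\delta+\delta^*c_{n,k}^{(1)}+c_{n,k}^{(2)}.$$ *)

(* Defs.v *)
From HB Require Import structures.
From mathcomp Require Import all_boot all_order all_algebra.
From mathcomp Require Import all_classical all_reals all_analysis.

Set Implicit Arguments.
Unset Strict Implicit.
Unset Printing Implicit Defensive.
Import Order.TTheory GRing.Theory Num.Theory.

Local Open Scope classical_set_scope.
Local Open Scope ring_scope.

(* Mutual independence of the random variables X i, i ranging over I: product
   rule for every finite subfamily. *)
Definition mutually_independent (d d' : measure_display) (T : measurableType d)
    (T' : measurableType d') (R : realType) (P : probability T R)
    (I : set nat) (X : nat -> {RV P >-> T'}) : Prop :=
  forall (J : seq nat), uniq J -> (forall i, i \in J -> I i) ->
  forall B : nat -> set T', (forall i, measurable (B i)) ->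
  P (\bigcap_(i in [set` J]) (X i @^-1` B i)) =
  (\prod_(i <- J) P (X i @^-1` B i))%E.

(* eta_1, ..., eta_n are independent with success probability p, and eta_0 = 1.
   The values of eta beyond n are unconstrained (and never used below). *)
Definition bernoulli_trials (d : measure_display) (T : measurableType d)
    (R : realType) (P : probability T R) (n : nat) (p : R)
    (eta : nat -> {RV P >-> bool}) : Prop :=
  [/\ forall t, eta 0%N t = true,
      forall i, (1 <= i <= n)%N ->
        P (eta i @^-1` [set true]) = p%:E /\
        P (eta i @^-1` [set false]) = (1 - p)%:E &
      mutually_independent [set i | (1 <= i <= n)%N] eta].

Section runs.
Variables (T : Type) (eta : nat -> T -> bool) (k1 k2 : nat).

Let k := (k1 + k2)%N.
Let x (i : nat) (t : T) : int := (eta i t : nat)%:Z.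

Definition run_indicator (l : nat) (t : T) : int :=
  x (l - 1) t
  * ((\prod_(1 <= i < k1.+1) (1 - x (l + i - 1) t))
     * (\prod_(1 <= j < k2.+1) x (l + k1 + j - 1) t))
  * (1 - x (l + k) t).

Definition run_count (n : nat) (t : T) : int :=
  \sum_(1 <= l < (n - k).+1) run_indicator l t.

End runs.

(* The state space {0, ..., N}; N = None stands for N = oo. *)
Definition gibbs_support (N : option nat) : set nat :=
  [set m | if N is Some N0 then (m <= N0)%N else true].

Section gibbs.
Variable R : realType.
Variables (N : option nat) (w : R) (U : nat -> R).

Definition gibbs_weight (m : nat) : R := expR (U m) * w ^+ m / m`!%:R.

Definition gibbs_law (d : measure_display) (T : measurableType d)
    (Q : probability T R) (beta : R) (Z : {RV Q >-> nat}) : Prop :=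
  beta%:E = \esum_(m in gibbs_support N) (gibbs_weight m)%:E /\
  forall m, gibbs_support N m ->
    Q (Z @^-1` [set m]) = (beta^-1 * gibbs_weight m)%:E.

(* e^{U(m+1) - U(m)}, with U = -oo off the state space: the value at m = N is
   0 when N is finite. For finite N, requiring that this equals a + b m on the
   whole state space thus includes a + b N = 0, without which the formula
   E(Z) = w a / (1 - w b) fails. *)
Definition gibbs_ratio (m : nat) : R :=
  if `[< gibbs_support N m.+1 >] then expR (U m.+1 - U m) else 0.

Definition stein_operator (g : int -> R) (m : nat) : R :=
  w * gibbs_ratio m * g (m.+1)%:Z - m%:R * g m%:Z.

Definition stein_solution (d : measure_display) (T : measurableType d)
    (Q : probability T R) (Z : {RV Q >-> nat}) (f g : int -> R) : Prop :=
  [/\ exists M : R, forall x : int, `|g x| <= M,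
      g 0 = 0,
      forall x : int,
        (forall m, gibbs_support N m -> x <> m%:Z) -> g x = 0 &
      forall m, gibbs_support N m ->
        (stein_operator g m)%:E =
        ((f m%:Z)%:E - 'E_Q[(fun t => f (Z t)%:Z)])%E].

End gibbs.

Section norms.
Variable R : realType.

(* sup over j in {0, 1, 2, ...} *)
Definition sup_delta (g : int -> R) : \bar R :=
  ereal_sup (range (fun j : nat => `|g (j.+1)%:Z - g j%:Z|%:E)).

Definition stein_factor (g : set int -> int -> R) : \bar R :=
  ereal_sup (range (fun A : set int => sup_delta (g A))).

Definition d_TV (d d' : measure_display) (T : measurableType d)
    (T' : measurableType d') (P : probability T R) (Q : probability T' R)
    (X : T -> int) (Y : T' -> int) : \bar R :=
  ereal_sup (range (fun A : set int =>
    `|P (X @^-1` A) - Q (Y @^-1` A)|%E)).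

End norms.

(* Exponents are natural numbers; for n >= 5k the subtractions in them are not
   truncated. *)
Section constants.
Variable R : realType.
Variables (n k : nat) (p : R).

Let q : R := 1 - p.
Let n' : R := n%:R.
Let k' : R := k%:R.

Definition delta_star : R := 1 + q + q * p.
Definition delta : R := 2 + delta_star * (k' + 2).
Definition delta1 : R :=
  delta_star * (5 * k' + 6 + (3 * k' ^+ 2 + 11 * k' + 10) / 2 * delta_star).
Definition delta2 : R := delta_star * (3 + (4 * k' + 7) / 2 * delta_star).

Definition c1 : R :=
  (n' - 2 * k' - 2) * (k' + 1)
  + (k' + 1) ^+ (n - k + 1) / (k' + 2) ^+ (n - k - 1).
Definition c2 : R :=
  n' - 3 * k' + k' * ((k' + 1) / (k' + 2)) ^+ (n - 2 * k).
Definition c3 : R :=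
  n' - 5 * k' + k' * (n' * k' + 6 * k' + 4 - k' ^+ 2)
    * ((k' + 1) ^+ (n - 3 * k - 1) / (k' + 2) ^+ (n - 3 * k + 1)).
Definition c4 : R :=
  n' * (3 * k' + 1) - (11 * k' ^+ 2 + 9 * k' + 2)
  + (2 * n' * k' + k' ^+ 2 + 7 * k' + 2)
    * ((k' + 1) / (k' + 2)) ^+ (n - 2 * k).
Definition c5 : R :=
  n' * (2 * k' + 3) - 6 * k' ^+ 2 - 16 * k' - 10
  + (2 * n' + 2 * k' + 5)
    * ((k' + 1) ^+ (n - k) / (k' + 2) ^+ (n - k - 1)).

Definition h1 : R :=
  (n' - k') * (4 + delta1) + delta2 * c1 + delta * c2 + c3
  + delta_star * c4 + delta_star ^+ 2 / 2 * c5.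
Definition h2 : R := (n' - k') * delta + delta_star * c1 + c2.

End constants.

(* Main.v *)
Require Import Defs.
From HB Require Import structures.
From mathcomp Require Import all_boot all_order all_algebra.
From mathcomp Require Import all_classical all_reals all_analysis.
From mathcomp Require Import measurable_realfun ring lra zify.
Set Implicit Arguments.
Unset Strict Implicit.
Unset Printing Implicit Defensive.
Import Order.TTheory GRing.Theory Num.Theory.
Local Open Scope ring_scope.

(** Write [W] for the number of runs, [mu] for the common mean, [c = w b], and
    let [f] be a solution of the Stein equation, with increments
    bounded by [rho].

    The recursion [(m + 1) P(Z = m + 1) = w (a + b m) P(Z = m)] gives
    [(1 - c) mu = w a] and [(1 - c) Var Z = mu]. Hence the expectation of the
    Stein operator at [W] is

      [(1 - c) (mu E f(W + 1) - E (W f(W))) + c E (W (f(W + 1) - f(W)))].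

    The indicator of a run at [l] is independent of those at distance more than
    [k + 1]. Expanding both brackets into sums of increments of [f], and
    decoupling each increment from the indicators that multiply it
    ([decouple], [telescope]), replaces every increment by
    [H = E (f(W + 2) - f(W + 1))] up to errors of higher order. The total
    coefficient of [H] is [mu - (1 - c) Var W = (1 - c) (Var Z - Var W)], which
    is the variance term of the bound ([stein_local_dependence]).

    The errors are sums of probabilities that two or three runs occur together
    in one neighbourhood. Two runs that overlap can only do so at distance
    exactly [k], and runs at distance at least [k] contain disjoint blocks of
    [k] trials; so a pair has probability at most [a(p)^2], a triple at most
    [a(p)^3] ([prob2_le], [prob3_le]), and most pairs have probability zero
    ([run_excl]). Counting the surviving terms gives at most
    [(n - k) (12 k^2 + 54 k + 60) a(p)^3] and [(n - k) (4 k + 10) a(p)^2],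
    and these are below [4 h1 a(p)^3] and [4 h2 a(p)^2] ([h1_ge], [h2_ge]).
    These probabilities are computed on the finite space of the configurations
    of the trials, whose law is a product law by independence ([P_config]).

    When [Z] lives on [{0, ..., N}] with [N] finite, [W] may exceed [N], where
    the Stein equation gives no information. There the solution is continued
    linearly with slope [- rho] ([extend_solution]). Since [w (a + b m)] is
    negative for [m > N], the Stein equation becomes the inequality that a
    one-sided bound needs, and complementation of the test set gives the other
    side. For this [rho] has to be at least [1 / (N - w b)], which follows from
    the Stein equation of the test set [{N}] ([slope_end]).

    An infinite Stein factor or an infinite variance of [Z] makes the right-hand
    side infinite, because the Stein factor is positive ([slope_gt0]) and
    [c < 1] ([wb_lt1]). *)

(** * Expectations over a finite probability space *)

Section FiniteExpectation.
Variables (R : realFieldType) (Om : finType) (pr : Om -> R).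

Definition Ex (f : Om -> R) : R := \sum_x pr x * f x.

Lemma eq_Ex f g : f =1 g -> Ex f = Ex g.
Proof. by move=> fg; apply: eq_bigr => x _; rewrite fg. Qed.

Lemma ExD f g : Ex (fun x => f x + g x) = Ex f + Ex g.
Proof. by rewrite /Ex -big_split; apply: eq_bigr => x _; rewrite mulrDr. Qed.

Lemma ExZ c f : Ex (fun x => c * f x) = c * Ex f.
Proof. by rewrite /Ex mulr_sumr; apply: eq_bigr => x _; rewrite mulrCA. Qed.

Lemma ExB f g : Ex (fun x => f x - g x) = Ex f - Ex g.
Proof.
rewrite -[X in _ = _ + X]mulN1r -ExZ -ExD.
by apply: eq_Ex => x; rewrite mulN1r.
Qed.

Lemma Ex_sum (J : Type) (s : seq J) (Q : pred J) (F : J -> Om -> R) :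
  Ex (fun x => \sum_(j <- s | Q j) F j x) = \sum_(j <- s | Q j) Ex (F j).
Proof.
rewrite /Ex exchange_big; apply: eq_bigr => x _.
by rewrite mulr_sumr.
Qed.

Hypothesis pr_ge0 : forall x, 0 <= pr x.
Hypothesis pr_sum1 : \sum_x pr x = 1.

Lemma Ex_cst c : Ex (fun=> c) = c.
Proof. by rewrite /Ex -mulr_suml pr_sum1 mul1r. Qed.

Lemma Ex_ge0 f : (forall x, 0 <= f x) -> 0 <= Ex f.
Proof. by move=> f0; apply: sumr_ge0 => x _; rewrite mulr_ge0. Qed.

Lemma Ex_le f g : (forall x, f x <= g x) -> Ex f <= Ex g.
Proof. by move=> fg; apply: ler_sum => x _; rewrite ler_wpM2l. Qed.

Lemma Ex_norm f g : (forall x, `|f x| <= g x) -> `|Ex f| <= Ex g.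
Proof.
move=> fg; apply: le_trans (Ex_le fg).
apply: le_trans (ler_norm_sum _ _ _) _.
by apply: ler_sum => x _; rewrite normrM (ger0_norm (pr_ge0 x)).
Qed.

(** * Stein's method for locally dependent indicators *)

Section LocalDependence.
Variables (I : finType) (X : I -> Om -> bool) (A : I -> {set I}).

Definition count_in (B : {set I}) (x : Om) : nat := \sum_(i in B) X i x.
Definition ind (i : I) (x : Om) : R := (X i x)%:R.
Definition prob1 (i : I) : R := Ex (ind i).
Definition prob2 (i j : I) : R := Ex (fun x => ind i x * ind j x).
Definition prob3 (i j l : I) : R := Ex (fun x => ind i x * ind j x * ind l x).

Local Notation total := (count_in [set: I]%SET).

Lemma ind_ge0 i x : 0 <= ind i x. Proof. exact: ler0n. Qed.

Lemma prob1_ge0 i : 0 <= prob1 i. Proof. exact: Ex_ge0 (ind_ge0 i). Qed.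

Lemma prob2_ge0 i j : 0 <= prob2 i j.
Proof. by apply: Ex_ge0 => x; rewrite mulr_ge0 ?ind_ge0. Qed.

Lemma count_inR (B : {set I}) x :
  (count_in B x)%:R = \sum_(i in B) ind i x :> R.
Proof. by rewrite /count_in natr_sum. Qed.

Lemma count_inU1 (B : {set I}) i x :
  i \notin B -> count_in (i |: B) x = (X i x + count_in B x)%N.
Proof. by move=> iB; rewrite /count_in finset.big_setU1. Qed.

Lemma count_in_set1 i x : count_in [set i]%SET x = X i x :> nat.
Proof. by rewrite /count_in finset.big_set1. Qed.

Section Bounded.
Variables (h : nat -> R) (rho : R).
Hypothesis h_bound : forall m, `|h m| <= rho.

Local Notation H := (Ex (fun x => h (total x).+1)).

(** A bounded function sees the passage from [D] to [B] only when some
    indicator indexed by [B :\: D] equals one, and the sum of these indicators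
    is then at least one. *)
Lemma count_in_change (D B : {set I}) x : D \subset B ->
  `|h (count_in B x).+1 - h (count_in D x).+1|
  <= 2 * rho * \sum_(i in B :\: D) ind i x.
Proof.
move=> DB; have -> : count_in B x = (count_in D x + count_in (B :\: D) x)%N.
  by rewrite /count_in (finset.big_setID D) /= (finset.setIidPr DB).
have rho0 : 0 <= rho by apply: le_trans (h_bound 0).
rewrite -count_inR; case: (count_in (B :\: D) x) => [|c].
  by rewrite addn0 subrr normr0 mulr0.
apply: le_trans (ler_normB _ _) _.
apply: le_trans (lerD (h_bound _) (h_bound _)) _.
have -> : rho + rho = 2 * rho by ring.
by rewrite ler_peMr ?mulr_ge0 ?ler0n // ler1n.
Qed.

(** Decoupling: delete from the argument of [h] everything that depends on
    [Y], use independence, and restore the full sum. *)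
Lemma decouple (Y : Om -> R) (D B : {set I}) :
  (forall x, 0 <= Y x) -> D \subset B ->
  Ex (fun x => Y x * h (count_in D x).+1)
    = Ex Y * Ex (fun x => h (count_in D x).+1) ->
  `|Ex (fun x => Y x * h (count_in B x).+1) - Ex Y * H|
  <= 2 * rho * (\sum_(i in B :\: D) Ex (fun x => Y x * ind i x)
                + Ex Y * \sum_(i in ~: D) prob1 i).
Proof.
move=> Y0 DB indep.
have -> : Ex (fun x => Y x * h (count_in B x).+1) - Ex Y * H
  = Ex (fun x => Y x * (h (count_in B x).+1 - h (count_in D x).+1))
    - Ex Y * Ex (fun x => h (total x).+1 - h (count_in D x).+1).
  have -> : Ex (fun x => Y x * (h (count_in B x).+1 - h (count_in D x).+1))
    = Ex (fun x => Y x * h (count_in B x).+1)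
      - Ex (fun x => Y x * h (count_in D x).+1).
    by rewrite -ExB; apply: eq_Ex => x; rewrite mulrBr.
  by rewrite ExB indep; ring.
apply: le_trans (ler_normB _ _) _; rewrite mulrDr; apply: lerD.
  rewrite -Ex_sum -ExZ; apply: Ex_norm => x.
  rewrite normrM (ger0_norm (Y0 x)) -mulr_sumr mulrCA ler_wpM2l //.
  exact: count_in_change.
rewrite normrM (ger0_norm (Ex_ge0 Y0)) mulrCA ler_wpM2l ?Ex_ge0 //.
rewrite -Ex_sum -ExZ; apply: Ex_norm => x.
by rewrite -finset.setTD; apply: count_in_change; exact: finset.subsetT.
Qed.

End Bounded.

Variables (g : nat -> R) (rho : R).
Let h (m : nat) : R := g m.+1 - g m.
Hypothesis h_bound : forall m, `|h m| <= rho.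

Local Notation H := (Ex (fun x => h (total x).+1)).

(** Switching on the indicators of [C] one at a time turns an increment of [g]
    into a sum of first differences, each with its own approximation. *)
Lemma telescope (Y : Om -> R) (c err : I -> R) (D C : {set I}) :
  [disjoint C & D] ->
  (forall m (B : {set I}), m \in C -> m \notin B -> D \subset B ->
     B \subset D :|: C ->
     `|Ex (fun x => Y x * ind m x * h (count_in B x).+1) - c m * H| <= err m) ->
  `|Ex (fun x => Y x * (g (count_in (D :|: C) x).+1 - g (count_in D x).+1))
    - (\sum_(m in C) c m) * H| <= \sum_(m in C) err m.
Proof.
move: {2}#|C| (leqnn #|C|) => s; elim: s C => [|s IH] C.
  rewrite leqn0 cards_eq0 => /eqP-> _ _.
  rewrite !finset.big_set0 finset.setU0 mul0r subr0.
  rewrite (eq_Ex (g := fun=> 0)); last by move=> x; rewrite subrr mulr0.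
  by rewrite Ex_cst normr0.
have [-> _|[m mC] Cs CD bound] := finset.set_0Vmem C.
  by apply: (IH finset.set0); rewrite cards0.
have mD : m \notin D by apply/negP => mD; move: CD;
  rewrite -finset.setI_eq0 => /eqP/finset.setP/(_ m); rewrite !finset.inE mC mD.
have CC : C :\ m \subset C by apply: finset.subD1set.
have CD' : [disjoint C :\ m & D] by apply: disjointWl CD.
have sz : (#|C :\ m| <= s)%N by move: Cs; rewrite (cardsD1 m) mC.
have bound' : forall m' (B : {set I}), m' \in C :\ m -> m' \notin B ->
    D \subset B -> B \subset D :|: (C :\ m) ->
    `|Ex (fun x => Y x * ind m' x * h (count_in B x).+1) - c m' * H| <= err m'.
  move=> m' B m'C m'B DB BC; apply: bound => //.
    by apply: (fintype.subsetP CC).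
  by apply: fintype.subset_trans BC _; apply: finset.setUS.
have {}IH := IH _ sz CD' bound'.
have mB : m \notin D :|: C :\ m by rewrite !finset.inE eqxx (negbTE mD).
have DCE : D :|: C = m |: (D :|: C :\ m).
  by rewrite finset.setUCA finset.setD1K.
have step := bound m (D :|: C :\ m) mC mB (finset.subsetUl _ _)
  (finset.setUS _ CC).
rewrite !(big_setD1 m mC) /=.
have -> : Ex (fun x => Y x * (g (count_in (D :|: C) x).+1 - g (count_in D x).+1))
  = Ex (fun x => Y x * ind m x * h (count_in (D :|: C :\ m) x).+1)
  + Ex (fun x => Y x * (g (count_in (D :|: C :\ m) x).+1 - g (count_in D x).+1)).
  rewrite -ExD; apply: eq_Ex => x; rewrite DCE count_inU1 // /ind /h.
  by case: (X m x) => /=; rewrite ?add1n ?add0n; ring.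
rewrite mulrDl opprD addrACA.
by apply: le_trans (ler_normD _ _) _; apply: lerD.
Qed.

Hypothesis A_refl : forall i, i \in A i.
Hypothesis indep1 : forall i (D : {set I}) (F : nat -> R), [disjoint D & A i] ->
  Ex (fun x => ind i x * F (count_in D x))
  = prob1 i * Ex (fun x => F (count_in D x)).
Hypothesis indep2 : forall i j (D : {set I}) (F : nat -> R), j \in A i ->
  [disjoint D & A i :|: A j] ->
  Ex (fun x => ind i x * ind j x * F (count_in D x))
  = prob2 i j * Ex (fun x => F (count_in D x)).

Definition near2 i : R := \sum_(j in A i :\ i) prob2 i j.
(** [err1 l m] is the cost of decoupling the indicator at [m] from sums over
    sets that contain everything outside [A l]; [err2 l m] is the cost for the
    product of the indicators at [l] and [m]. *)
Definition err1 l m : R :=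
  near2 m + prob1 m * \sum_(i in A l :|: A m) prob1 i.
Definition err2 l m : R :=
  \sum_(i in (A l :|: A m) :\ l :\ m) prob3 l m i
  + prob2 l m * \sum_(i in A l :|: A m) prob1 i.

Definition remainder1 : R :=
  2 * \sum_l (prob1 l * \sum_(m in A l) err1 l m
              + \sum_(m in A l :\ l) err2 l m).
Definition remainder2 : R := 2 * \sum_l err1 l l.

Let mean : R := \sum_l prob1 l.

Lemma prob2xx i : prob2 i i = prob1 i.
Proof.
by apply: eq_Ex => x; rewrite /ind; case: (X i x); rewrite ?mulr1 ?mulr0.
Qed.

Lemma Ex_total : Ex (fun x => (total x)%:R) = mean.
Proof.
under eq_Ex => x do rewrite count_inR.
by rewrite Ex_sum; apply: eq_bigl => i; rewrite finset.in_setT.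
Qed.

(** Indicators outside the neighbourhood of [l] are uncorrelated with the one
    at [l], so the variance is a sum over neighbouring pairs. *)
Lemma variance_local :
  Ex (fun x => ((total x)%:R - mean) ^+ 2)
  = \sum_l (prob1 l + near2 l - prob1 l * \sum_(m in A l) prob1 m).
Proof.
have -> : Ex (fun x => ((total x)%:R - mean) ^+ 2)
  = \sum_l \sum_m (prob2 l m - prob1 l * prob1 m).
  have -> : \sum_l \sum_m (prob2 l m - prob1 l * prob1 m)
      = \sum_l \sum_m prob2 l m - mean ^+ 2.
    rewrite expr2 /mean mulr_suml -sumrB; apply: eq_bigr => l _.
    by rewrite sumrB mulr_sumr.
  have sq x : ((total x)%:R - mean) ^+ 2 = \sum_l \sum_m ind l x * ind m x
      - (mean *+ 2) * (total x)%:R + mean ^+ 2.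
    have -> : \sum_l \sum_m ind l x * ind m x = (total x)%:R ^+ 2.
      rewrite expr2 count_inR mulr_suml; apply: eq_big => [l|l _].
        by rewrite finset.in_setT.
      by rewrite mulr_sumr; apply: eq_bigl => i; rewrite finset.in_setT.
    by ring.
  rewrite (eq_Ex sq) ExD ExB Ex_cst ExZ Ex_total Ex_sum.
  under eq_bigr => l _ do rewrite Ex_sum.
  rewrite -/mean; ring.
apply: eq_bigr => l _.
rewrite (bigID (mem (A l))) /= [X in _ + X]big1 ?addr0; last first.
  move=> m mA; apply/eqP; rewrite subr_eq0; apply/eqP.
  have dis : [disjoint [set m]%SET & A l] by rewrite disjoints1.
  have := @indep1 l [set m]%SET (fun s => s%:R) dis.
  rewrite (eq_Ex (g := fun x => ind l x * ind m x)); last first.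
    by move=> x; rewrite count_in_set1.
  rewrite (@eq_Ex (fun x => (count_in [set m]%SET x)%:R) (ind m)) //.
  by move=> x; rewrite count_in_set1.
rewrite sumrB -mulr_sumr; congr (_ - _).
by rewrite (big_setD1 l (A_refl l)) /= prob2xx.
Qed.

Lemma disjointDl (B C D : {set I}) : C \subset D -> [disjoint B :\: D & C].
Proof.
move=> CD; rewrite -finset.setI_eq0; apply/eqP/finset.setP => i.
rewrite !finset.inE; apply/negP => /andP[/andP[iD _] iC].
by rewrite (fintype.subsetP CD _ iC) in iD.
Qed.

Lemma Ex_ind_approx l m (B : {set I}) :
  m \in A l -> m \notin B -> ~: A l \subset B ->
  `|Ex (fun x => 1 * ind m x * h (count_in B x).+1) - prob1 m * H|
  <= 2 * rho * err1 l m.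
Proof.
move=> ml mB AB; set D := B :\: A m.
have rho0 : 0 <= rho by apply: le_trans (h_bound 0).
have DB : D \subset B by apply: finset.subsetDl.
have ind1 : (fun x => 1 * ind m x * h (count_in B x).+1)
          = (fun x => ind m x * h (count_in B x).+1).
  by apply/funext => x; rewrite mul1r.
rewrite ind1; apply: le_trans (decouple h_bound (ind_ge0 m) DB _) _.
  exact: (indep1 (fun s => h s.+1)) (disjointDl _ (fintype.subxx _)).
rewrite ler_wpM2l ?mulr_ge0 ?ler0n //; apply: lerD.
  rewrite [X in _ <= X](big_setID (B :\: D)) /= ler_wpDr //.
    by apply: sumr_ge0 => i _; apply: prob2_ge0.
  rewrite le_eqVlt; apply/orP; left; apply/eqP; apply: eq_bigl => i.
  rewrite /D !finset.inE; case: (eqVneq i m) => [->|] /=; last first.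
    by case: (i \in A m); case: (i \in B).
  by rewrite (negbTE mB) !andbF.
rewrite ler_wpM2l ?prob1_ge0 //.
rewrite [X in _ <= X](big_setID (~: D)) /= ler_wpDr //.
  by apply: sumr_ge0 => i _; apply: prob1_ge0.
rewrite le_eqVlt; apply/orP; left; apply/eqP; apply: eq_bigl => i.
rewrite /D !finset.inE.
have := fintype.subsetP AB i; rewrite finset.inE.
by case: (i \in A l); case: (i \in A m); case: (i \in B) => //= /(_ isT).
Qed.

Lemma Ex_ind2_approx l m (B : {set I}) :
  m \in A l :\ l -> m \notin B -> l \notin B -> ~: A l \subset B ->
  `|Ex (fun x => ind l x * ind m x * h (count_in B x).+1) - prob2 l m * H|
  <= 2 * rho * err2 l m.
Proof.
rewrite finset.in_setD1 => /andP[ml mA] mB lB AB; set D := B :\: (A l :|: A m).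
have rho0 : 0 <= rho by apply: le_trans (h_bound 0).
have DB : D \subset B by apply: finset.subsetDl.
have Y0 x : 0 <= ind l x * ind m x by rewrite mulr_ge0 ?ind_ge0.
apply: le_trans (decouple h_bound Y0 DB _) _.
  exact: (indep2 (fun s => h s.+1)) mA (disjointDl _ (fintype.subxx _)).
rewrite ler_wpM2l ?mulr_ge0 ?ler0n //; apply: lerD.
  rewrite [X in _ <= X](big_setID (B :\: D)) /= ler_wpDr //.
    by apply: sumr_ge0 => i _; apply: Ex_ge0 => x; rewrite mulr_ge0 ?ind_ge0.
  rewrite le_eqVlt; apply/orP; left; apply/eqP; apply: eq_bigl => i.
  rewrite /D !finset.inE; case: (eqVneq i m) => [->|im] /=.
    by rewrite (negbTE mB) !andbF.
  case: (eqVneq i l) => [->|il] /=; first by rewrite (negbTE lB) !andbF.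
  by case: (i \in A l); case: (i \in A m); case: (i \in B).
rewrite ler_wpM2l ?prob2_ge0 //.
rewrite [X in _ <= X](big_setID (~: D)) /= ler_wpDr //.
  by apply: sumr_ge0 => i _; apply: prob1_ge0.
rewrite le_eqVlt; apply/orP; left; apply/eqP; apply: eq_bigl => i.
rewrite /D !finset.inE.
have := fintype.subsetP AB i; rewrite finset.inE.
by case: (i \in A l); case: (i \in A m); case: (i \in B) => //= /(_ isT).
Qed.

Let first_part :
  `|mean * Ex (fun x => g (total x).+1) - Ex (fun x => (total x)%:R * g (total x))
    - (\sum_l (prob1 l * (\sum_(m in A l) prob1 m) - near2 l)) * H|
  <= rho * remainder1.
Proof.
have rho0 : 0 <= rho by apply: le_trans (h_bound 0).
pose a l := Ex (fun x => 1 * (g (count_in (~: A l :|: A l) x).+1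
                              - g (count_in (~: A l) x).+1)).
pose b l := Ex (fun x => ind l x * (g (count_in (~: A l :|: A l :\ l) x).+1
                                    - g (count_in (~: A l) x).+1)).
have aH l : `|a l - (\sum_(m in A l) prob1 m) * H|
    <= \sum_(m in A l) 2 * rho * err1 l m.
  apply: telescope => [|m B mA mB DB _].
    by rewrite -finset.setI_eq0 finset.setICr.
  exact: Ex_ind_approx.
have bH l : `|b l - near2 l * H| <= \sum_(m in A l :\ l) 2 * rho * err2 l m.
  have lD : l \notin ~: A l by rewrite finset.inE A_refl.
  apply: telescope => [|m B mA mB DB BC].
    rewrite -finset.setI_eq0; apply/eqP/finset.setP => i; rewrite !finset.inE.
    by case: (i \in A l); rewrite ?andbF.
  apply: Ex_ind2_approx => //; apply/negP => /(fintype.subsetP BC).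
  by rewrite !finset.inE eqxx A_refl.
have -> : mean * Ex (fun x => g (total x).+1)
          - Ex (fun x => (total x)%:R * g (total x))
        = \sum_l (prob1 l * a l - b l).
  have -> : Ex (fun x => (total x)%:R * g (total x))
          = \sum_l Ex (fun x => ind l x * g (total x)).
    rewrite -Ex_sum; apply: eq_Ex => x; rewrite count_inR mulr_suml.
    by apply: eq_bigl => i; rewrite finset.in_setT.
  rewrite mulr_suml -sumrB; apply: eq_bigr => l _.
  have dis : [disjoint ~: A l & A l].
    by rewrite -finset.setI_eq0 finset.setIC finset.setICr.
  have -> : b l = Ex (fun x => ind l x * g (total x))
              - prob1 l * Ex (fun x => g (count_in (~: A l) x).+1).
    rewrite -(indep1 (fun s => g s.+1) dis) -ExB; apply: eq_Ex => x.
    have -> : total x = count_in (l |: (~: A l :|: A l :\ l)) x.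
      congr count_in; apply/finset.setP => i; rewrite !finset.inE.
      by case: eqP => //= _; case: (i \in A l).
    rewrite count_inU1 ?finset.inE ?eqxx ?A_refl //.
    by rewrite /ind; case: (X l x) => /=; rewrite ?add1n; ring.
  have -> : a l = Ex (fun x => g (total x).+1)
              - Ex (fun x => g (count_in (~: A l) x).+1).
    rewrite -ExB; apply: eq_Ex => x; rewrite mul1r.
    by rewrite finset.setUC finset.setUCr.
  ring.
rewrite mulr_suml -sumrB /remainder1 mulrCA mulr_sumr mulr_sumr.
apply: le_trans (ler_norm_sum _ _ _) _; apply: ler_sum => l _.
have -> : prob1 l * a l - b l
    - (prob1 l * (\sum_(m in A l) prob1 m) - near2 l) * H
  = prob1 l * (a l - (\sum_(m in A l) prob1 m) * H) - (b l - near2 l * H).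
  ring.
have -> : 2 * (rho * (prob1 l * (\sum_(m in A l) err1 l m)
                      + \sum_(m in A l :\ l) err2 l m))
  = prob1 l * (\sum_(m in A l) 2 * rho * err1 l m)
    + \sum_(m in A l :\ l) 2 * rho * err2 l m.
  rewrite -!mulr_sumr; ring.
apply: le_trans (ler_normB _ _) _; apply: lerD => //.
by rewrite normrM (ger0_norm (prob1_ge0 l)) ler_wpM2l ?prob1_ge0.
Qed.

Let second_part :
  `|Ex (fun x => (total x)%:R * h (total x)) - mean * H| <= rho * remainder2.
Proof.
have -> : Ex (fun x => (total x)%:R * h (total x))
        = \sum_l Ex (fun x => 1 * ind l x * h (count_in (~: [set l])%SET x).+1).
  rewrite -Ex_sum; apply: eq_Ex => x; rewrite count_inR mulr_suml.
  apply: eq_big => [l|l _]; first by rewrite finset.in_setT.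
  have -> : total x = count_in (l |: ~: [set l])%SET x.
    by congr count_in; rewrite finset.setUCr.
  rewrite count_inU1 ?finset.inE ?eqxx // mul1r /ind.
  by case: (X l x); rewrite ?add1n // !mul0r.
rewrite /mean mulr_suml -sumrB /remainder2 mulrCA mulr_sumr mulr_sumr.
apply: le_trans (ler_norm_sum _ _ _) _; apply: ler_sum => l _.
rewrite mulrA; apply: Ex_ind_approx; rewrite ?finset.inE ?eqxx ?A_refl //.
by rewrite finset.setCS finset.sub1set.
Qed.

(** The Stein operator of a birth-death law with birth rates
    [(1 - c) * mean + c * m] and death rates [m] is a combination of the two
    expectations treated above. Both are, up to second order errors, multiples
    of [H], and the total coefficient of [H] is the variance mismatch. *)
Theorem stein_local_dependence (c : R) :
  `|(1 - c) * (mean * Ex (fun x => g (total x).+1)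
               - Ex (fun x => (total x)%:R * g (total x)))
    + c * Ex (fun x => (total x)%:R * (g (total x).+1 - g (total x)))|
  <= rho * (`|mean - (1 - c) * Ex (fun x => ((total x)%:R - mean) ^+ 2)|
            + `|1 - c| * remainder1 + `|c| * remainder2).
Proof.
have rho0 : 0 <= rho by apply: le_trans (h_bound 0).
rewrite variance_local; set V := \sum_l _.
have VE : \sum_l (prob1 l * (\sum_(m in A l) prob1 m) - near2 l) = mean - V.
  rewrite /V /mean -sumrB; apply: eq_bigr => l _; ring.
have := first_part; have := second_part; rewrite VE.
set T2 := Ex (fun x => (total x)%:R * _); set T1 := _ - Ex _ => b2 b1.
have -> : (1 - c) * T1 + c * T2 = H * (mean - (1 - c) * V)
    + (1 - c) * (T1 - (mean - V) * H) + c * (T2 - mean * H) by ring.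
rewrite [rho * (_ + _ + _)]mulrDr [rho * (_ + _)]mulrDr.
apply: le_trans (ler_normD _ _) _; apply: lerD.
  apply: le_trans (ler_normD _ _) _; apply: lerD; rewrite normrM.
    rewrite ler_wpM2r //; apply: le_trans (Ex_norm (g := fun=> rho) _) _.
      by move=> x; apply: h_bound.
    by rewrite Ex_cst.
  by rewrite mulrCA ler_wpM2l.
by rewrite normrM mulrCA ler_wpM2l.
Qed.

End LocalDependence.
End FiniteExpectation.

(** * Products of Bernoulli laws *)

Section ProductSpace.
Variables (R : realFieldType) (C : finType) (w : C -> bool -> R).
Hypothesis w_ge0 : forall c b, 0 <= w c b.
Hypothesis w_sum1 : forall c, w c true + w c false = 1.

Local Notation Om := {ffun C -> bool}.

Definition prod_weight (x : Om) : R := \prod_c w c (x c).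

Local Notation E := (Ex prod_weight).

Lemma prod_weight_ge0 x : 0 <= prod_weight x.
Proof. by apply: prodr_ge0 => c _; apply: w_ge0. Qed.

Lemma Ex_prod (f : C -> bool -> R) :
  E (fun x => \prod_c f c (x c)) = \prod_c (w c true * f c true
                                           + w c false * f c false).
Proof.
rewrite (eq_bigr (fun c => \sum_b w c b * f c b)); last first.
  by move=> c _; rewrite big_bool.
by rewrite bigA_distr_bigA /=; apply: eq_bigr => x _; rewrite -big_split.
Qed.

Lemma prod_weight_sum1 : \sum_x prod_weight x = 1.
Proof.
have := Ex_prod (fun _ _ => 1).
rewrite [RHS]big1 => [<-|c _]; last by rewrite !mulr1.
by apply: eq_bigr => x _; rewrite big1 ?mulr1.
Qed.

Definition depends_on (V : Type) (K : {set C}) (f : Om -> V) : Prop :=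
  forall x y : Om, (forall c, c \in K -> x c = y c) -> f x = f y.

(** Exchanging the coordinates outside [K] between two independent copies
    preserves the joint law, and it brings the arguments of [f] and of [g]
    together in one copy. *)
Lemma Ex_indep (K : {set C}) (f g : Om -> R) :
  depends_on K f -> depends_on (~: K) g ->
  E (fun x => f x * g x) = E f * E g.
Proof.
move=> fK gK.
pose mix (x y : Om) : Om := [ffun c => if c \in K then x c else y c].
pose swap (u : Om * Om) := (mix u.1 u.2, mix u.2 u.1).
have swapK : involutive swap.
  by move=> [x y]; rewrite /swap /=; congr (_, _); apply/ffunP => c;
    rewrite !ffunE; case: (c \in K).
have -> : E f * E g
    = \sum_u prod_weight u.1 * prod_weight u.2 * (f u.1 * g u.2).
  rewrite /Ex mulr_suml -(pair_big xpredT xpredT (fun x y =>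
    prod_weight x * prod_weight y * (f x * g y))) /=.
  apply: eq_bigr => x _; rewrite mulr_sumr; apply: eq_bigr => y _; ring.
rewrite (reindex_inj (inv_inj swapK)) /=.
have -> : E (fun x => f x * g x)
    = \sum_u prod_weight u.1 * prod_weight u.2 * (f u.1 * g u.1).
  rewrite -(pair_big xpredT xpredT (fun x y =>
    prod_weight x * prod_weight y * (f x * g x))) /=.
  apply: eq_bigr => x _; under eq_bigr do rewrite -mulrA mulrCA.
  by rewrite -mulr_suml prod_weight_sum1 mul1r.
apply: eq_bigr => -[x y] _ /=; congr (_ * (_ * _)).
- rewrite /prod_weight -!big_split; apply: eq_bigr => c _ /=.
  by rewrite !ffunE; case: (c \in K); rewrite // mulrC.
- by apply: fK => c cK; rewrite ffunE cK.
- by apply: gK => c; rewrite finset.inE ffunE => /negbTE->.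
Qed.

End ProductSpace.

(** * Runs in a Bernoulli sequence *)

Section RunPattern.
Variables (k1 k2 : nat).
Let k := (k1 + k2)%N.

(** Positions are shifted by one: this is the pattern counted by the indicator
    of index [i.+1]. *)
Definition run_at (s : nat -> bool) (i : nat) : bool :=
  [&& s i, all (fun j => ~~ s (i + j)%N) (iota 1 k1),
      all (fun j => s (i + k1 + j)%N) (iota 1 k2) & ~~ s (i + k).+1].

Lemma run_atP (s : nat -> bool) i : reflect
  [/\ s i, forall c, (i < c <= i + k1)%N -> s c = false,
      forall c, (i + k1 < c <= i + k)%N -> s c & s (i + k).+1 = false]
  (run_at s i).
Proof.
apply: (iffP and4P) => [[si /allP z /allP o /negbTE e]|[si z o e]]; split=> //.
- move=> c /andP[ic ck].
  have := z (c - i)%N; rewrite mem_iota subnKC ?(ltnW ic) // => H.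
  by apply/negbTE/H; lia.
- move=> c /andP[ic ck].
  have := o (c - (i + k1))%N; rewrite mem_iota subnKC ?(ltnW ic) //; apply.
  by rewrite /k in ck; lia.
- by apply/allP => j; rewrite mem_iota => jk; rewrite z //; lia.
- by apply/allP => j; rewrite mem_iota => jk; apply: o; rewrite /k; lia.
- by rewrite e.
Qed.

Lemma run_indicatorE (T : Type) (eta : nat -> T -> bool) (i : nat) (t : T) :
  run_indicator eta k1 k2 i.+1 t = (run_at (eta^~ t) i : nat)%:Z.
Proof.
have prodb (Q : pred nat) (a b : nat) :
    \prod_(a <= j < b) ((Q j : nat)%:Z) = ((all Q (index_iota a b) : nat)%:Z).
  elim: (index_iota a b) => [|j s IH]; first by rewrite big_nil.
  by rewrite big_cons IH /=; case: (Q j); rewrite ?mul1r ?mul0r.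
rewrite /run_indicator subn1 /= -/k /run_at addSn.
rewrite (eq_bigr (fun j => ((~~ eta (i + j)%N t : nat)%:Z))); last first.
  by move=> j _; rewrite addSn subn1 /=; case: (eta _ t).
rewrite prodb.
rewrite (eq_bigr (fun j => ((eta (i + k1 + j)%N t : nat)%:Z))); last first.
  by move=> j _; rewrite !addSn subn1.
rewrite (prodb (fun j => eta (i + k1 + j)%N t)) /index_iota !subn1 /=.
by case: (eta i t); case: (all _ _); case: (all _ _); case: (eta _ t).
Qed.

Lemma eq_run_at (s s' : nat -> bool) i :
  (forall c, (i <= c <= (i + k).+1)%N -> s c = s' c) ->
  run_at s i = run_at s' i.
Proof.
move=> ss; have kE : k = (k1 + k2)%N by [].
suff imp (u u' : nat -> bool) :
    (forall c, (i <= c <= (i + k).+1)%N -> u c = u' c) ->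
    run_at u i -> run_at u' i.
  by apply/idP/idP; apply: imp => // c /ss.
move=> uu /run_atP[ui z o e]; apply/run_atP; split.
- by rewrite -uu //; lia.
- by move=> c ck; rewrite -uu ?z //; lia.
- by move=> c ck; rewrite -uu ?o //; lia.
- by rewrite -uu //; lia.
Qed.

(** A run starts with a descent 10 and ends with another one at distance [k].
    There is no descent in between, and no run starts at the last trial, which
    is a failure. *)
Lemma run_at_apart (s : nat -> bool) i j :
  (0 < k1)%N -> (i < j)%N -> run_at s i -> run_at s j ->
  j = (i + k)%N \/ (i + k.+1 < j)%N.
Proof.
move=> k1_gt0 ij /run_atP[_ zi oi ei] /run_atP[sj zj _ _].
have [jk|jk] := leqP j (i + k1)%N; first by rewrite zi ?ij in sj.
have [jk'|] := ltnP j (i + k)%N; last first.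
  rewrite leq_eqVlt => /orP[/eqP<-|]; [by left|move=> ikj; right].
  rewrite ltn_neqAle addnS ikj andbT; apply/eqP => jE.
  by rewrite -jE ei in sj.
have : s j.+1 by apply: oi; lia.
by rewrite zj //; lia.
Qed.

End RunPattern.

Lemma card_window (M lo s : nat) (B : {set 'I_M}) :
  (forall i, i \in B -> (lo <= i < lo + s)%N) -> (#|B| <= s)%N.
Proof.
move=> Bs; rewrite cardE -(size_map val) -(size_iota lo s).
apply: uniq_leq_size; first by rewrite (map_inj_uniq val_inj) enum_uniq.
by move=> _ /mapP[i iB ->]; rewrite mem_iota Bs // -mem_enum.
Qed.

(** A run has at most two partners at distance [k], and such a pair has at most
    two further partners: sums over neighbourhoods have two terms. *)
Lemma sum_two_le (R : realFieldType) (M u v : nat) (B : {set 'I_M})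
    (F : 'I_M -> R) (c : R) : 0 <= c ->
  (forall i, i \in B -> (i : nat) = u \/ (i : nat) = v -> F i <= c) ->
  (forall i, i \in B -> (i : nat) <> u -> (i : nat) <> v -> F i <= 0) ->
  \sum_(i in B) F i <= 2 * c.
Proof.
move=> c0 Fc F0; rewrite (bigID (fun i : 'I_M => (i == u :> nat) || (i == v :> nat))) /=.
rewrite -[leRHS]addr0; apply: lerD; last first.
  apply: sumr_le0 => i /andP[iB]; rewrite negb_or => /andP[/eqP iu /eqP iv].
  exact: F0.
pose S := finset (fun i : 'I_M => (i \in B) && ((i == u :> nat) || (i == v :> nat))).
apply: (@le_trans _ _ (\sum_(i in S) c)).
  apply: (@le_trans _ _ (\sum_(i in S) F i)).
    by rewrite le_eqVlt; apply/orP; left; apply/eqP; apply: eq_bigl => i;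
      rewrite /S finset.inE.
  apply: ler_sum => i; rewrite /S finset.inE => /andP[iB /orP[]/eqP iE];
    by apply: Fc => //; tauto.
rewrite sumr_const -[_ *+ #|_|]mulr_natl ler_wpM2r // (ler_nat _ _ 2).
have card1 t : (#|finset (fun i : 'I_M => i == t :> nat)| <= 1)%N.
  by apply: (@card_window _ t) => i; rewrite finset.inE; lia.
apply: leq_trans (leq_add (card1 u) (card1 v)).
apply: leq_trans (leq_card_setU _ _); apply: subset_leq_card.
by apply/fintype.subsetP => i; rewrite /S !finset.inE => /andP[].
Qed.

(** * The local dependence of runs *)

Section RunGeometry.
Variables (k1 k2 n : nat).
Local Notation k := (k1 + k2)%N.
Local Notation M := (n - k)%N.

Local Notation Om := {ffun 'I_n.+1 -> bool}.

Definition run (i : 'I_M) (x : Om) : bool :=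
  run_at k1 k2 (fun c => x (inord c)) i.
Definition run_nbhd (i : 'I_M) : {set 'I_M} :=
  finset (fun j : 'I_M => (i <= j + k.+1)%N && (j <= i + k.+1)%N).
Definition window (lo hi : nat) : {set 'I_n.+1} :=
  finset (fun c : 'I_n.+1 => (lo <= c <= hi)%N).

Lemma window_inord (lo hi c : nat) : (c <= n)%N ->
  (inord c \in window lo hi) = (lo <= c <= hi)%N.
Proof. by move=> cn; rewrite finset.inE inordK. Qed.

Lemma run_depends (i : 'I_M) : depends_on (window i (i + k).+1) (run i).
Proof.
move=> x y xy; apply: eq_run_at => c ck; apply: xy.
by rewrite window_inord //; have := ltn_ord i; lia.
Qed.

Lemma count_depends (D : {set 'I_M}) (K : {set 'I_n.+1}) :
  (forall j, j \in D -> window j (j + k).+1 \subset K) ->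
  depends_on K (count_in run D).
Proof.
move=> DK x y xy; apply: eq_bigr => j jD; congr nat_of_bool.
apply: run_depends => c cj; apply: xy.
exact: (fintype.subsetP (DK j jD)).
Qed.

Lemma window_apart (i j : 'I_M) : j \notin run_nbhd i ->
  window j (j + k).+1 \subset ~: window i (i + k).+1.
Proof.
rewrite finset.inE => ij; apply/fintype.subsetP => c.
by rewrite !finset.inE => cj; apply/negP => ci; lia.
Qed.

Lemma run_nbhd_refl i : i \in run_nbhd i.
Proof. by rewrite finset.inE !leq_addr. Qed.

Lemma card_nbhdU (i j : 'I_M) : j \in run_nbhd i ->
  (#|run_nbhd i :|: run_nbhd j| <= 3 * k + 4)%N.
Proof.
rewrite finset.inE => ij.
apply: (@card_window _ (minn i j - k.+1)) => l; rewrite !finset.inE; lia.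
Qed.

Lemma card_nbhd (i : 'I_M) : (#|run_nbhd i| <= 2 * k + 3)%N.
Proof.
apply: (@card_window _ (i - k.+1)) => l; rewrite !finset.inE; lia.
Qed.

Lemma run_excl (i j : 'I_M) x : (0 < k1)%N -> j \in run_nbhd i -> j != i ->
  (j : nat) <> (i + k)%N -> (i : nat) <> (j + k)%N ->
  run i x -> run j x -> False.
Proof.
rewrite finset.inE => k1_gt0 /andP[ij ji] jNi jk ik ri rj.
case: (ltngtP i j) => [lt|lt|/val_inj E]; last by rewrite E eqxx in jNi.
  by case: (run_at_apart k1_gt0 lt ri rj) => //; lia.
by case: (run_at_apart k1_gt0 lt rj ri) => //; lia.
Qed.

End RunGeometry.

Section RunLaw.
Variables (R : realFieldType) (k1 k2 n : nat) (p : R).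
Hypotheses (p_gt0 : 0 < p) (p_lt1 : p < 1).
Local Notation k := (k1 + k2)%N.
Local Notation M := (n - k)%N.

Local Notation Om := {ffun 'I_n.+1 -> bool}.

(** Trial [0] is a certain success: it has a point mass instead of a
    Bernoulli law. *)
Definition trial_weight (c : 'I_n.+1) (b : bool) : R :=
  if val c == 0%N then b%:R else if b then p else 1 - p.

Local Notation pr := (prod_weight trial_weight).
Local Notation E := (Ex pr).

Lemma trial_weight_ge0 c b : 0 <= trial_weight c b.
Proof.
by rewrite /trial_weight; case: eqP => _; case: b; rewrite ?ler0n ?ltW // subr_gt0.
Qed.

Lemma trial_weight_sum1 c : trial_weight c true + trial_weight c false = 1.
Proof. by rewrite /trial_weight; case: eqP => _; rewrite ?addr0 // subrKC. Qed.

Let pr_ge0 := prod_weight_ge0 trial_weight_ge0.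
Let pr_sum1 := prod_weight_sum1 trial_weight_sum1.
Let Ex_indep := Ex_indep trial_weight_sum1.

Local Notation X := (@run k1 k2 n).
Local Notation A := (@run_nbhd k1 k2 n).
Local Notation prob1 := (prob1 pr X).
Local Notation prob2 := (prob2 pr X).
Local Notation prob3 := (prob3 pr X).
Local Notation ind := (ind R X).

Lemma run_indep1 i (D : {set 'I_M}) (F : nat -> R) :
  [disjoint D & A i] ->
  E (fun x => ind i x * F (count_in X D x))
  = prob1 i * E (fun x => F (count_in X D x)).
Proof.
move=> dis; apply: (Ex_indep (K := window n i (i + k).+1)).
  by move=> x y xy; rewrite /ind (run_depends xy).
move=> x y xy; congr F; apply: (count_depends _ xy) => j jD.
by apply: window_apart; rewrite (disjointFr dis jD).
Qed.

Lemma run_indep2 i j (D : {set 'I_M}) (F : nat -> R) :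
  j \in A i -> [disjoint D & A i :|: A j] ->
  E (fun x => ind i x * ind j x * F (count_in X D x))
  = prob2 i j * E (fun x => F (count_in X D x)).
Proof.
move=> _ dis.
apply: (Ex_indep (K := window n i (i + k).+1 :|: window n j (j + k).+1)).
  move=> x y xy; rewrite /ind; congr ((_ : bool)%:R * (_ : bool)%:R).
    by apply: run_depends => c ck; apply: xy; rewrite finset.inE ck.
  by apply: run_depends => c ck; apply: xy; rewrite finset.inE ck orbT.
move=> x y xy; congr F; apply: (count_depends _ xy) => l lD.
have := disjointFr dis lD; rewrite finset.inE => /norP[li lj].
by rewrite finset.setCU finset.subsetI !window_apart.
Qed.

Local Notation a := ((1 - p) ^+ k1 * p ^+ k2).

Let a_ge0 : 0 <= a.
Proof. by rewrite mulr_ge0 ?exprn_ge0 ?subr_ge0 ?ltW. Qed.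

(** The [k] central trials of a run. Unlike full runs, these blocks are
    independent as soon as they start at distance [k]. *)
Definition block_factor (i : nat) (c : 'I_n.+1) (b : bool) : R :=
  if (i < c <= i + k1)%N then (~~ b)%:R
  else if (i + k1 < c <= i + k)%N then b%:R else 1.
Definition block (i : nat) (x : Om) : R := \prod_c block_factor i c (x c).

Lemma block_ge0 i x : 0 <= block i x.
Proof.
by apply: prodr_ge0 => c _; rewrite /block_factor; do 2?case: ifP.
Qed.

Lemma ind_le_block (i : 'I_M) x : ind i x <= block i x.
Proof.
rewrite /ind; case: (boolP (run i x)) => [/run_atP[_ z o _]|_]; last first.
  exact: block_ge0.
rewrite /block big1 // => c _; rewrite /block_factor.
have cE : x c = x (inord c) by congr (x _); apply: val_inj; rewrite /= inordK.
case: ifP => [cz|_]; first by rewrite cE z.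
by case: ifP => // co; rewrite cE o.
Qed.

Lemma block_depends i : depends_on (window n i.+1 (i + k)) (block i).
Proof.
move=> x y xy; apply: eq_bigr => c _; rewrite /block_factor.
case: ifP => [ck|_]; first by rewrite xy // finset.inE; lia.
by case: ifP => // ck; rewrite xy // finset.inE; lia.
Qed.

Lemma Ex_block i : (i + k <= n)%N -> E (block i) = a.
Proof.
move=> ik; rewrite (Ex_prod trial_weight (block_factor i)).
pose F (c : nat) : R := if (i < c <= i + k1)%N then 1 - p
  else if (i + k1 < c <= i + k)%N then p else 1.
rewrite (eq_bigr (fun c : 'I_n.+1 => F c)); last first.
  move=> c _; rewrite /F /trial_weight /block_factor.
  have [ck|_] := boolP (i < c <= i + k1)%N; last first.
    have [ck|_] := boolP (i + k1 < c <= i + k)%N; last first.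
      by rewrite !mulr1; apply: trial_weight_sum1.
    have -> : (val c == 0%N) = false by rewrite /=; lia.
    by rewrite mulr0 mulr1 addr0.
  have -> : (val c == 0%N) = false by rewrite /=; lia.
  by rewrite mulr0 mulr1 add0r.
rewrite -(big_mkord xpredT F).
rewrite (@big_cat_nat _ _ _ i.+1 0) /=; [|by lia|by lia].
rewrite (@big_cat_nat _ _ _ (i + k1).+1 i.+1 n.+1) /=; [|by lia|by lia].
rewrite (@big_cat_nat _ _ _ (i + k).+1 (i + k1).+1 n.+1) /=; [|by lia|by lia].
rewrite [X in X * _]big_nat_cond big1 ?mul1r; last first.
  by move=> c /andP[/andP[ck1 ck2] _]; rewrite /F !ifN //; lia.
rewrite [X in _ * (_ * X)]big_nat_cond [X in _ * (_ * X)]big1 ?mulr1; last first.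
  by move=> c /andP[/andP[ck1 ck2] _]; rewrite /F !ifN //; lia.
rewrite (eq_big_nat _ _ (F2 := fun=> 1 - p)); last first.
  by move=> c ck; rewrite /F ifT //; lia.
rewrite [X in _ * X](eq_big_nat _ _ (F2 := fun=> p)); last first.
  by move=> c ck; rewrite /F ifN ?ifT //; lia.
by rewrite !prodr_const_nat; congr (_ ^+ _ * _ ^+ _); lia.
Qed.

Let lt_M (i : 'I_M) : (i + k <= n)%N.
Proof. by have := ltn_ord i; lia. Qed.

Lemma prob1_le i : prob1 i <= a.
Proof. by rewrite -(Ex_block (lt_M i)); apply: Ex_le => // x; apply: ind_le_block. Qed.

Lemma Ex_block2 i j : (i + k <= n)%N -> (j + k <= n)%N ->
  (i + k <= j)%N \/ (j + k <= i)%N -> E (fun x => block i x * block j x) = a ^+ 2.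
Proof.
move=> ik jk ij; rewrite (Ex_indep (K := window n i.+1 (i + k))).
- by rewrite !Ex_block // expr2.
- exact: block_depends.
- move=> x y xy; apply: block_depends => c cj; apply: xy.
  by move: cj; rewrite !finset.inE => cj; apply/negP => ci; lia.
Qed.

Lemma prob2_le (i j : 'I_M) : (i + k <= j)%N \/ (j + k <= i)%N ->
  prob2 i j <= a ^+ 2.
Proof.
move=> ij; rewrite -(Ex_block2 (lt_M i) (lt_M j) ij); apply: Ex_le => // x.
by apply: ler_pM; rewrite ?ind_ge0 ?ind_le_block.
Qed.

Lemma prob3_le (i j l : 'I_M) : (i + k <= j)%N \/ (j + k <= i)%N ->
  (i + k <= l)%N \/ (l + k <= i)%N -> (j + k <= l)%N \/ (l + k <= j)%N ->
  prob3 i j l <= a ^+ 3.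
Proof.
move=> ij il jl.
have -> : a ^+ 3 = E (fun x => block i x * (block j x * block l x)).
  rewrite (Ex_indep (K := window n i.+1 (i + k))) ?Ex_block ?Ex_block2 //.
  - exact: block_depends.
  - move=> x y xy; congr (_ * _); apply: block_depends => c cj; apply: xy;
      by move: cj; rewrite !finset.inE => cj; apply/negP => ci; lia.
apply: Ex_le => // x; rewrite -mulrA.
by apply: ler_pM; rewrite ?mulr_ge0 ?ind_ge0 ?ind_le_block //;
   apply: ler_pM; rewrite ?ind_ge0 ?ind_le_block.
Qed.

Hypothesis k1_gt0 : (0 < k1)%N.

Lemma ind_excl (i j : 'I_M) x : j \in A i -> j != i ->
  (j : nat) <> (i + k)%N -> (i : nat) <> (j + k)%N -> ind i x * ind j x = 0.
Proof.
move=> ij jNi jk ik; rewrite /ind.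
case: (boolP (run i x)) => [ri|]; last by rewrite mul0r.
case: (boolP (run j x)) => [rj|]; last by rewrite mulr0.
by case: (run_excl k1_gt0 ij jNi jk ik ri rj).
Qed.

Lemma prob2_eq0 (i j : 'I_M) : j \in A i -> j != i ->
  (j : nat) <> (i + k)%N -> (i : nat) <> (j + k)%N -> prob2 i j = 0.
Proof.
move=> ij ji jk ik; rewrite /prob2 (@eq_Ex _ _ _ _ (fun=> 0)) ?Ex_cst //.
by move=> x; apply: ind_excl.
Qed.

Lemma near2_le i : near2 pr X A i <= 2 * a ^+ 2.
Proof.
have a2 : 0 <= a ^+ 2 by rewrite exprn_ge0.
(* The value [M] is out of range, for when [i - k] does not exist. *)
pose v := if (k <= i)%N then (i - k)%N else M.
apply: (@sum_two_le _ _ (i + k) v) => // [j|j]; rewrite finset.in_setD1.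
  move=> /andP[_ _] jE; apply: prob2_le.
  by move: jE; rewrite /v; have := ltn_ord j; case: (leqP k i); lia.
move=> /andP[ji jA] jk jv; rewrite prob2_eq0 // => iE; apply: jv.
by rewrite /v iE leq_addl addnK.
Qed.

Lemma sum_prob1_le (B : {set 'I_M}) s : (#|B| <= s)%N ->
  \sum_(i in B) prob1 i <= s%:R * a.
Proof.
move=> Bs; apply: (@le_trans _ _ (\sum_(i in B) a)).
  by apply: ler_sum => i _; apply: prob1_le.
by rewrite sumr_const -[_ *+ #|_|]mulr_natl ler_wpM2r // ler_nat.
Qed.

Lemma err1_le l m s : (#| A l :|: A m| <= s)%N ->
  err1 pr X A l m <= (2 + s%:R) * a ^+ 2.
Proof.
move=> cs; rewrite mulrDl; apply: lerD; first exact: near2_le.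
rewrite expr2 mulrA [_ * a]mulrC; apply: ler_pM; rewrite ?prob1_le //.
- exact: prob1_ge0.
- by apply: sumr_ge0 => i _; apply: prob1_ge0.
- exact: sum_prob1_le.
Qed.

Lemma remainder2_le :
  remainder2 pr X A <= M%:R * (4 * k%:R + 10) * a ^+ 2.
Proof.
have -> : M%:R * (4 * k%:R + 10) * a ^+ 2
    = 2 * \sum_(l < M) (2 + (2 * k + 3)%:R) * a ^+ 2.
  by rewrite sumr_const card_ord -[_ *+ M]mulr_natl; ring.
rewrite ler_wpM2l ?ler0n //; apply: ler_sum => l _; apply: err1_le.
by rewrite finset.setUid card_nbhd.
Qed.

Lemma err2_far l m : m \in A l -> m != l ->
  (m : nat) <> (l + k)%N -> (l : nat) <> (m + k)%N ->
  err2 pr X A l m <= 0.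
Proof.
move=> ml mNl mk lk; rewrite /err2 prob2_eq0 // mul0r addr0 big1 // => i _.
rewrite /prob3 (@eq_Ex _ _ _ _ (fun=> 0)) ?Ex_cst // => x.
by rewrite ind_excl ?mul0r.
Qed.

Lemma err2_near l m : m \in A l -> m != l ->
  (m : nat) = (l + k)%N \/ (l : nat) = (m + k)%N ->
  err2 pr X A l m <= (3 * k%:R + 6) * a ^+ 3.
Proof.
move=> ml mNl mk; have a3 : 0 <= a ^+ 3 by rewrite exprn_ge0.
have -> : (3 * k%:R + 6) * a ^+ 3
    = 2 * a ^+ 3 + a ^+ 2 * ((3 * k + 4)%:R * a) by ring.
apply: lerD; last first.
  apply: ler_pM; rewrite ?prob2_ge0 //.
  - by apply: sumr_ge0 => i _; apply: prob1_ge0.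
  - by apply: prob2_le; lia.
  - exact: sum_prob1_le (card_nbhdU ml).
(* The third runs [i] in question are the reflections of one of [l], [m] in
   the other, when they exist. *)
pose refl (u v : nat) := if (v <= 2 * u)%N then (2 * u - v)%N else M.
apply: (@sum_two_le _ _ (refl l m) (refl m l)) => // i.
  move=> _ iE; apply: prob3_le; move: iE; rewrite /refl;
    by have := ltn_ord i; case: (leqP m (2 * l)); case: (leqP l (2 * m)); lia.
rewrite !finset.in_setD1 finset.in_setU => /and3P[im il iU] i1 i2.
have {}i1 : (i + m)%N <> (2 * l)%N.
  by move=> iE; apply: i1; rewrite /refl; case: leqP; lia.
have {}i2 : (i + l)%N <> (2 * m)%N.
  by move=> iE; apply: i2; rewrite /refl; case: leqP; lia.
rewrite /prob3 (@eq_Ex _ _ _ _ (fun=> 0)) ?Ex_cst // => x.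
have iml : (i : nat) <> l by move=> /val_inj iE; rewrite iE eqxx in il.
have imm : (i : nat) <> m by move=> /val_inj iE; rewrite iE eqxx in im.
case/orP: iU => iA.
  by rewrite mulrAC ind_excl ?mul0r //; lia.
by rewrite -mulrA ind_excl ?mulr0 //; lia.
Qed.

Lemma remainder1_le :
  remainder1 pr X A
  <= M%:R * (12 * k%:R ^+ 2 + 54 * k%:R + 60) * a ^+ 3.
Proof.
have a3 : 0 <= (3 * k%:R + 6) * a ^+ 3.
  have k0 : 0 <= k%:R :> R by exact: ler0n.
  by apply: mulr_ge0; [lra|exact: exprn_ge0].
have -> : M%:R * (12 * k%:R ^+ 2 + 54 * k%:R + 60) * a ^+ 3
    = 2 * \sum_(l < M) (a * ((2 * k + 3)%:R * ((2 + (3 * k + 4)%:R) * a ^+ 2))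
                        + 2 * ((3 * k%:R + 6) * a ^+ 3)).
  rewrite sumr_const card_ord -[_ *+ M]mulr_natl; ring.
rewrite ler_wpM2l ?ler0n //; apply: ler_sum => l _; apply: lerD.
  have e0 : 0 <= (2 + (3 * k + 4)%:R) * a ^+ 2.
    by apply: mulr_ge0; [exact: addr_ge0|exact: exprn_ge0].
  have sum_le : \sum_(m in A l) err1 pr X A l m
      <= (2 * k + 3)%:R * ((2 + (3 * k + 4)%:R) * a ^+ 2).
    apply: (@le_trans _ _ (\sum_(m in A l)
                            (2 + (3 * k + 4)%:R) * a ^+ 2)).
      by apply: ler_sum => m ml; apply/err1_le/card_nbhdU.
    by rewrite sumr_const -[_ *+ #|_|]mulr_natl ler_wpM2r // ler_nat card_nbhd.
  apply: (@le_trans _ _ (prob1 l * ((2 * k + 3)%:R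
                          * ((2 + (3 * k + 4)%:R) * a ^+ 2)))).
    by rewrite ler_wpM2l ?prob1_ge0.
  by rewrite ler_wpM2r ?prob1_le // mulr_ge0.
pose v := if (k <= l)%N then (l - k)%N else M.
apply: (@sum_two_le _ _ (l + k) v) => // m; rewrite finset.in_setD1.
  move=> /andP[ml mA] mE; apply: err2_near => //.
  by move: mE; rewrite /v; have := ltn_ord m; case: (leqP k l); lia.
move=> /andP[ml mA] mk mv; apply: err2_far => // lE; apply: mv.
by rewrite /v lE leq_addl addnK.
Qed.

End RunLaw.

(** * Lower bounds for the constants *)

Section Constants.
Variables (R : realType) (n k : nat) (p : R).
Hypotheses (p_gt0 : 0 < p) (p_lt1 : p < 1).
Hypotheses (k_ge2 : (2 <= k)%N) (kn : (5 * k <= n)%N).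
Local Notation k' := (k%:R : R).
Local Notation n' := (n%:R : R).

Let k'_ge2 : 2 <= k'. Proof. by rewrite (ler_nat R 2). Qed.
Let kn' : 5 * k' <= n'. Proof. by rewrite -(natrM R 5) ler_nat. Qed.

Lemma delta_star_ge1 : 1 <= delta_star p.
Proof.
have [p0 p1 k2 nk5] := And4 p_gt0 p_lt1 k'_ge2 kn'.
have : 0 <= (1 - p) * p by rewrite mulr_ge0 //; lra.
rewrite /delta_star; lra.
Qed.

Lemma c1_ge : (n' - 2 * k' - 2) * (k' + 1) <= c1 R n k.
Proof.
have [p0 p1 k2 nk5] := And4 p_gt0 p_lt1 k'_ge2 kn'.
by rewrite /c1 lerDl divr_ge0 ?exprn_ge0 //; lra.
Qed.

Let ratio_ge0 s : 0 <= ((k' + 1) / (k' + 2)) ^+ s.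
Proof.
have [p0 p1 k2 nk5] := And4 p_gt0 p_lt1 k'_ge2 kn'.
by rewrite exprn_ge0 // divr_ge0 //; lra.
Qed.

Lemma c2_ge0 : 0 <= c2 R n k.
Proof.
have [p0 p1 k2 nk5] := And4 p_gt0 p_lt1 k'_ge2 kn'.
by rewrite /c2; apply: addr_ge0; [lra|apply: mulr_ge0; [lra|exact: ratio_ge0]].
Qed.

Lemma c3_ge0 : 0 <= c3 R n k.
Proof.
have [p0 p1 k2 nk5] := And4 p_gt0 p_lt1 k'_ge2 kn'.
rewrite /c3; apply: addr_ge0; first by lra.
apply: mulr_ge0; first by apply: mulr_ge0; [lra|nra].
by rewrite divr_ge0 ?exprn_ge0 //; lra.
Qed.

Lemma c4_ge0 : 0 <= c4 R n k.
Proof.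
have [p0 p1 k2 nk5] := And4 p_gt0 p_lt1 k'_ge2 kn'.
by rewrite /c4; apply: addr_ge0; [nra|apply: mulr_ge0 => //; nra].
Qed.

Lemma c5_ge0 : 0 <= c5 R n k.
Proof.
have [p0 p1 k2 nk5] := And4 p_gt0 p_lt1 k'_ge2 kn'.
rewrite /c5; apply: addr_ge0; first by nra.
by apply: mulr_ge0; [lra|rewrite divr_ge0 ?exprn_ge0 //; lra].
Qed.

Lemma h2_ge : (n' - k') * (4 * k' + 10) <= 4 * h2 n k p.
Proof.
have [p0 p1 k2 nk5] := And4 p_gt0 p_lt1 k'_ge2 kn'.
have D1 := delta_star_ge1; have c2p := c2_ge0.
have c1p : 0 <= c1 R n k by apply: le_trans c1_ge; nra.
have dE : k' + 4 <= delta k p by rewrite /delta; nra.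
have : (n' - k') * (k' + 4) <= (n' - k') * delta k p.
  by rewrite ler_wpM2l //; lra.
have : 0 <= delta_star p * c1 R n k by rewrite mulr_ge0 //; lra.
rewrite /h2; nra.
Qed.

(** The first two terms of [h1] suffice, even with [delta_star] replaced by 1.
    With [n = 5 k + t] and [k = 2 + s], what remains is that a polynomial in [s]
    and [t] has nonnegative coefficients. *)
Lemma h1_ge : (n' - k') * (12 * k' ^+ 2 + 54 * k' + 60) <= 4 * h1 n k p.
Proof.
have [p0 p1 k2 nk5] := And4 p_gt0 p_lt1 k'_ge2 kn'.
have D1 := delta_star_ge1; have D0 : 0 <= delta_star p by lra.
have D2 : 1 <= delta_star p ^+ 2 by rewrite expr_ge1.
have d1 : (3 * k' ^+ 2 + 21 * k' + 22) / 2 <= delta1 k p.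
  have -> : delta1 k p = (5 * k' + 6) * delta_star p
      + (3 * k' ^+ 2 + 11 * k' + 10) / 2 * delta_star p ^+ 2.
    rewrite /delta1; ring.
  nra.
have d2 : (4 * k' + 13) / 2 <= delta2 k p.
  have -> : delta2 k p = 3 * delta_star p
      + (4 * k' + 7) / 2 * delta_star p ^+ 2 by rewrite /delta2; ring.
  nra.
have e1 : (n' - k') * ((3 * k' ^+ 2 + 21 * k' + 30) / 2)
    <= (n' - k') * (4 + delta1 k p).
  by rewrite ler_wpM2l //; lra.
have e2 : (4 * k' + 13) / 2 * ((n' - 2 * k' - 2) * (k' + 1))
    <= delta2 k p * c1 R n k.
  by apply: ler_pM => //; [apply: mulr_ge0; lra|exact: c1_ge].
have e3 : 0 <= delta k p * c2 R n k.
  by rewrite mulr_ge0 ?c2_ge0 // /delta; nra.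
have e4 : 0 <= delta_star p * c4 R n k by rewrite mulr_ge0 ?c4_ge0.
have e5 : 0 <= delta_star p ^+ 2 / 2 * c5 R n k.
  by rewrite mulr_ge0 ?c5_ge0 //; lra.
have e6 := c3_ge0.
have key : (n' - k') * (6 * k' ^+ 2 + 12 * k')
    <= (8 * k' ^+ 2 + 34 * k' + 26) * (n' - 2 * k' - 2).
  have [t nE] : exists t, n' = 5 * k' + t by exists (n' - 5 * k'); ring.
  have t0 : 0 <= t by move: nk5; rewrite nE; lra.
  have [s kE] : exists s, k' = 2 + s by exists (k' - 2); ring.
  have s0 : 0 <= s by move: k2; rewrite kE; lra.
  rewrite -subr_ge0 nE kE.
  have -> : (8 * (2 + s) ^+ 2 + 34 * (2 + s) + 26) * (5 * (2 + s) + t - 2 * (2 + s) - 2)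
      - (5 * (2 + s) + t - (2 + s)) * (6 * (2 + s) ^+ 2 + 12 * (2 + s))
    = 38 * s ^+ 2 + 162 * s + 120 + t * (2 * s ^+ 2 + 30 * s + 78) by ring.
  have : 0 <= s ^+ 2 by rewrite exprn_ge0.
  have : 0 <= t * (2 * s ^+ 2 + 30 * s + 78).
    by rewrite mulr_ge0 //; nra.
  by lra.
by rewrite /h1; nra.
Qed.

End Constants.

(** * Stein's bound for the number of runs *)

Section RunStein.
Variables (R : realType) (k1 k2 n : nat) (p : R).
Hypotheses (k1_gt0 : (0 < k1)%N) (k2_gt0 : (0 < k2)%N).
Hypotheses (p_gt0 : 0 < p) (p_lt1 : p < 1).
Hypothesis kn : (5 * (k1 + k2) <= n)%N.
Local Notation k := (k1 + k2)%N.
Local Notation Om := {ffun 'I_n.+1 -> bool}.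
Local Notation pr := (prod_weight (trial_weight p)).
Local Notation E := (Ex pr).

Definition runs (x : Om) : nat :=
  count_in (@run k1 k2 n) [set: 'I_(n - k)]%SET x.

Local Notation mean := (E (fun x => (runs x)%:R)).
Local Notation var := (E (fun x => ((runs x)%:R - mean) ^+ 2)).
Local Notation a := ((1 - p) ^+ k1 * p ^+ k2).

Theorem runs_stein (g : nat -> R) (rho c : R) :
  (forall m, `|g m.+1 - g m| <= rho) ->
  `|(1 - c) * (mean * E (fun x => g (runs x).+1)
               - E (fun x => (runs x)%:R * g (runs x)))
    + c * E (fun x => (runs x)%:R * (g (runs x).+1 - g (runs x)))|
  <= rho * (2 * (2 + (1 - p) * p) * a ^+ 2
            * (`|1 - c| * h1 n k p * a + `|c| * h2 n k p)
            + `|mean - (1 - c) * var|).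
Proof.
move=> g_rho; have rho0 : 0 <= rho by apply: le_trans (g_rho 0).
have w0 := @trial_weight_ge0 R n p p_gt0 p_lt1.
have w1 := @trial_weight_sum1 R n p.
have := @stein_local_dependence R Om pr (prod_weight_ge0 w0)
  (prod_weight_sum1 w1) _ (@run k1 k2 n) (@run_nbhd k1 k2 n)
  g rho g_rho (@run_nbhd_refl k1 k2 n)
  (@run_indep1 R k1 k2 n p) (@run_indep2 R k1 k2 n p) c.
have meanE := @Ex_total R Om pr _ (@run k1 k2 n).
rewrite -meanE => bound; apply: le_trans bound _; rewrite ler_wpM2l //.
rewrite -addrA addrC lerD2r.
have q0 : 0 <= (1 - p) * p by rewrite mulr_ge0 ?subr_ge0 ?ltW.
have a0 : 0 <= a by rewrite mulr_ge0 ?exprn_ge0 ?subr_ge0 ?ltW.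
have k_ge2 : (2 <= k)%N by lia.
have nk : (n - k)%:R = n%:R - k%:R :> R by rewrite natrB //; lia.
have nk0 : 0 <= (n - k)%:R :> R by exact: ler0n.
have k0 : 0 <= k%:R :> R by exact: ler0n.
have sq0 : 0 <= (k%:R : R) ^+ 2 by rewrite exprn_ge0.
have scale (r h u v : R) : r <= u * v -> 0 <= u -> u <= 4 * h ->
    0 <= v -> 0 <= v * h -> r <= 2 * (2 + (1 - p) * p) * v * h.
  move=> ruv u0 uh v0 vh; apply: (le_trans ruv).
  apply: (@le_trans _ _ (4 * h * v)); first by rewrite ler_wpM2r.
  have : 0 <= (1 - p) * p * (v * h) by rewrite mulr_ge0.
  lra.
have b1 : remainder1 pr (@run k1 k2 n) (@run_nbhd k1 k2 n)
    <= 2 * (2 + (1 - p) * p) * a ^+ 3 * h1 n k p.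
  have H := h1_ge p_gt0 p_lt1 k_ge2 kn.
  have u0 : 0 <= (n%:R - k%:R) * (12 * k%:R ^+ 2 + 54 * k%:R + 60) :> R.
    by rewrite -nk; apply: mulr_ge0 => //; lra.
  apply: scale (H) _ _ => //; rewrite ?exprn_ge0 //.
    rewrite -nk; exact: remainder1_le.
  by rewrite mulr_ge0 ?exprn_ge0 //; lra.
have b2 : remainder2 pr (@run k1 k2 n) (@run_nbhd k1 k2 n)
    <= 2 * (2 + (1 - p) * p) * a ^+ 2 * h2 n k p.
  have H := h2_ge p_gt0 p_lt1 k_ge2 kn.
  have u0 : 0 <= (n%:R - k%:R) * (4 * k%:R + 10) :> R.
    by rewrite -nk; apply: mulr_ge0 => //; lra.
  apply: scale (H) _ _ => //; rewrite ?exprn_ge0 //.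
    rewrite -nk; exact: remainder2_le.
  by rewrite mulr_ge0 ?exprn_ge0 //; lra.
have -> : 2 * (2 + (1 - p) * p) * a ^+ 2
          * (`|1 - c| * h1 n k p * a + `|c| * h2 n k p)
  = `|1 - c| * (2 * (2 + (1 - p) * p) * a ^+ 3 * h1 n k p)
    + `|c| * (2 * (2 + (1 - p) * p) * a ^+ 2 * h2 n k p) by ring.
by apply: lerD; rewrite ler_wpM2l.
Qed.

Lemma factor_gt0 (c : R) : c < 1 ->
  0 < 2 * (2 + (1 - p) * p) * a ^+ 2
      * (`|1 - c| * h1 n k p * a + `|c| * h2 n k p).
Proof.
move=> c1; have p0 := p_gt0; have p1 := p_lt1.
have k_ge2 : (2 <= k)%N by lia.
have H1 := h1_ge p_gt0 p_lt1 k_ge2 kn; have H2 := h2_ge p_gt0 p_lt1 k_ge2 kn.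
have q0 : 0 < (1 - p) * p by rewrite mulr_gt0 ?subr_gt0.
have a0 : 0 < a by rewrite mulr_gt0 ?exprn_gt0 ?subr_gt0.
have k'0 : 0 <= k%:R :> R by exact: ler0n.
have nk0 : 0 < n%:R - k%:R :> R by rewrite subr_gt0 ltr_nat; lia.
have sq0 : 0 <= (k%:R : R) ^+ 2 by rewrite exprn_ge0.
have h1p : 0 < h1 n k p.
  have : 0 < (n%:R - k%:R) * (12 * k%:R ^+ 2 + 54 * k%:R + 60) :> R.
    by rewrite mulr_gt0 //; lra.
  lra.
have h2p : 0 <= h2 n k p.
  have : 0 <= (n%:R - k%:R) * (4 * k%:R + 10) :> R.
    by apply: mulr_ge0; lra.
  lra.
apply: mulr_gt0; first by rewrite mulr_gt0 ?exprn_gt0 //; lra.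
apply: ltr_wpDr; first by rewrite mulr_ge0.
apply: mulr_gt0 => //; apply: mulr_gt0 => //.
by rewrite gtr0_norm subr_gt0.
Qed.

(** The configuration that starts with the pattern has positive weight. *)
Lemma runs_mean_gt0 : 0 < mean.
Proof.
have nk : (0 < n - k)%N by lia.
pose i0 : 'I_(n - k) := Ordinal nk.
pose x0 : Om := [ffun c : 'I_n.+1 => (c == 0%N :> nat) || (k1 < c <= k)%N].
have w0 := @trial_weight_ge0 R n p p_gt0 p_lt1.
have x0_gt0 : 0 < pr x0.
  apply: prodr_gt0 => c _; rewrite /trial_weight ffunE.
  by case: eqP => //= _; case: ifP => _ //; rewrite subr_gt0.
have x0E (c : nat) : (c <= n)%N -> x0 (inord c) = (c == 0%N) || (k1 < c <= k)%N.
  by move=> cn; rewrite ffunE inordK.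
have run0 : run i0 x0.
  apply/run_atP; split.
  - by rewrite x0E.
  - by move=> c; rewrite /= add0n => ck; rewrite x0E; lia.
  - by move=> c; rewrite /= add0n => ck; rewrite x0E; lia.
  - by rewrite /= add0n x0E; lia.
have runs0 : 1 <= (runs x0)%:R :> R.
  by rewrite ler1n /runs /count_in (big_setD1 i0) ?finset.in_setT //= run0.
apply: (@lt_le_trans _ _ (pr x0 * (runs x0)%:R)).
  by rewrite mulr_gt0 //; lra.
rewrite /Ex (bigD1 x0) //= lerDl; apply: sumr_ge0 => x _.
by rewrite mulr_ge0 ?prod_weight_ge0.
Qed.

End RunStein.

Import numFieldNormedType.Exports.
Local Open Scope classical_set_scope.

(** * The law of the trials *)

Section Transfer.
Variables (R : realType) (k1 k2 n : nat) (p : R).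
Variables (d : measure_display) (T : measurableType d) (P : probability T R).
Variable eta : nat -> {RV P >-> bool}.
Hypothesis heta : bernoulli_trials n p eta.
Local Notation Om := {ffun 'I_n.+1 -> bool}.
Local Notation pr := (prod_weight (trial_weight p)).
Local Notation k := (k1 + k2)%N.

Definition config (t : T) : Om := [ffun c : 'I_n.+1 => eta c t].

Lemma config_preimage (x : Om) : config @^-1` [set x] =
  \bigcap_(i in [set` iota 0 n.+1]) (eta i @^-1` [set x (inord i)]).
Proof.
apply/seteqP; split => t /=.
  move=> <- i iI; have : i \in iota 0 n.+1 := iI.
  by rewrite mem_iota => ilt; rewrite /= ffunE inordK.
move=> tx; apply/ffunP => c; rewrite ffunE.
have -> : x c = x (inord c) by congr (x _); apply: val_inj; rewrite /= inordK.
have cI : nat_of_ord c \in iota 0 n.+1 by rewrite mem_iota add0n ltn_ord.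
exact: (tx _ cI).
Qed.

Lemma measurable_config (x : Om) : measurable (config @^-1` [set x]).
Proof.
rewrite config_preimage; apply: bigcap_measurableType => i _.
by rewrite -[X in measurable X]setTI; apply: measurable_funP.
Qed.

Lemma P_config (x : Om) : P (config @^-1` [set x]) = (pr x)%:E.
Proof.
have [eta0 law indep] := heta.
have -> : pr x = trial_weight p (ord0 : 'I_n.+1) (x ord0)
                 * \prod_(i <- iota 1 n) (if x (inord i) then p else 1 - p).
  rewrite /prod_weight big_ord_recl; congr (_ * _).
  have -> : iota 1 n = index_iota 1 n.+1 by rewrite /index_iota subn1.
  rewrite big_add1 big_mkord; apply: eq_bigr => i _.
  have -> : inord i.+1 = lift ord0 i :> 'I_n.+1.
    by apply: val_inj; rewrite /= inordK // ltnS.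
  by [].
have [x0|x0] := boolP (x ord0); last first.
  rewrite /trial_weight /= mul0r (_ : _ @^-1` _ = set0) ?measure0 //.
  apply/seteqP; split => // t /= tx; move: x0.
  by rewrite -tx ffunE /= eta0.
rewrite /trial_weight /= mul1r config_preimage /=.
have -> : \bigcap_(i in [set` iota 0 n.+1]) (eta i @^-1` [set x (inord i)])
        = \bigcap_(i in [set` iota 1 n]) (eta i @^-1` [set x (inord i)]).
  apply/seteqP; split => t tx i /= iI.
    by apply: tx; rewrite /= in_cons iI orbT.
  move: iI; rewrite in_cons => /orP[/eqP ->|]; last exact: tx.
  rewrite /= eta0; have -> : inord 0 = ord0 :> 'I_n.+1.
    by apply: val_inj; rewrite /= inordK.
  by rewrite x0.
rewrite (indep _ (iota_uniq _ _)) //; last first.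
  by move=> i; rewrite mem_iota add1n ltnS.
rewrite -prodEFin [LHS]big_seq [RHS]big_seq; apply: eq_bigr => i.
rewrite mem_iota add1n ltnS => iI; have [pt pf] := law i iI.
by case: (x (inord i)).
Qed.

Lemma expectation_config (F : Om -> R) :
  ('E_P[(fun t => F (config t))] = (Ex pr F)%:E)%E.
Proof.
rewrite unlock.
have -> : (fun t => (F (config t))%:E)
    = (fun t => \sum_(x : Om) (F x * \1_(config @^-1` [set x]) t)%:E)%E.
  apply/funext => t; rewrite (bigD1 (config t)) //= big1 ?adde0.
    by rewrite indicE mem_set //= mulr1.
  move=> x xt; rewrite indicE memNset ?mulr0 //= => tx.
  by rewrite tx eqxx in xt.
have fin x : P.-integrable setT (EFin \o (\1_(config @^-1` [set x]) : T -> R)).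
  by apply: integrable_indic => //; exact: measurable_config.
rewrite integral_sum //; last first.
  move=> x; under eq_fun => t do rewrite EFinM.
  by apply: integrableZl => //; exact: fin.
rewrite /Ex -sumEFin; apply: eq_bigr => x _.
under eq_integral => t _ do rewrite EFinM.
rewrite integralZl //; last exact: fin.
rewrite integral_indic //; last exact: measurable_config.
rewrite setIT; transitivity ((F x)%:E * (pr x)%:E)%E.
  by congr (_ * _)%E; exact: P_config.
by rewrite -EFinM mulrC.
Qed.

Lemma run_count_config t :
  run_count eta k1 k2 n t = (runs k1 k2 (config t) : nat)%:Z.
Proof.
rewrite /run_count /runs /count_in big_add1 /= big_mkord.
rewrite (eq_bigl xpredT); last by move=> i; rewrite finset.in_setT.
rewrite (big_morph Posz PoszD (erefl _)); apply: eq_bigr => i _.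
rewrite run_indicatorE; congr (Posz (nat_of_bool _)).
apply: eq_run_at => c ck; rewrite ffunE inordK //.
by have := ltn_ord i; lia.
Qed.

Local Notation W := (@runs k1 k2 n).

Lemma expectation_run_count :
  ('E_P[(fun t => (run_count eta k1 k2 n t)%:~R)]
   = (Ex pr (fun x => (W x)%:R))%:E)%E.
Proof.
rewrite -expectation_config; congr expectation; apply/funext => t.
by rewrite run_count_config.
Qed.

Lemma variance_run_count :
  ('V_P[(fun t => (run_count eta k1 k2 n t)%:~R)]
   = (Ex pr (fun x => ((W x)%:R - Ex pr (fun y => (W y)%:R)) ^+ 2))%:E)%E.
Proof.
rewrite /variance covariance.unlock expectation_run_count /=.
rewrite -expectation_config; congr expectation; apply/funext => t.
have <- : (run_count eta k1 k2 n t)%:~R = (W (config t))%:R :> R.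
  by rewrite run_count_config.
by rewrite expr2.
Qed.

Lemma measurable_run_count (A : set int) :
  measurable (run_count eta k1 k2 n @^-1` A).
Proof.
have -> : run_count eta k1 k2 n @^-1` A
    = \bigcup_(x in [set x : Om | A (W x)%:Z]) (config @^-1` [set x]).
  apply/seteqP; split => t /=; first by rewrite run_count_config => At;
    exists (config t).
  by move=> [x /= Ax tx]; rewrite run_count_config tx.
apply: fin_bigcup_measurable => [|x _]; first exact: finite_finset.
exact: measurable_config.
Qed.

Lemma P_run_count (A : set int) :
  P (run_count eta k1 k2 n @^-1` A) = (Ex pr (fun x => \1_A (W x)%:Z))%:E.
Proof.
rewrite -expectation_config -(expectation_indic P (measurable_run_count A)).
congr expectation; apply/funext => t.
by rewrite !indicE -run_count_config.
Qed.

End Transfer.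

(** * Discrete Gibbs measures *)

Lemma seq_cvg_unique (R : realType) (u : nat -> R) (s t : R) :
  u @ \oo --> s -> u @ \oo --> t -> s = t.
Proof. by move=> /cvg_lim <- // /cvg_lim <-. Qed.

Lemma series_shift (R : realType) (u : nat -> R) (s : R) :
  series u @ \oo --> s -> series (fun m => u m.+1) @ \oo --> s - u 0%N.
Proof.
move=> us.
have -> : series (fun m => u m.+1) = (fun n => series u n.+1 - u 0%N).
  apply/funext => n; rewrite /series /= big_nat_recl //= addrC addrA.
  by rewrite addNr add0r.
by apply: cvgB; [rewrite cvg_shiftS|exact: cvg_cst].
Qed.

Lemma series_lin (R : realType) (u v w : nat -> R) (x y z s t r : R) :
  series u @ \oo --> s -> series v @ \oo --> t -> series w @ \oo --> r ->
  series (fun m => x * u m + y * v m + z * w m) @ \oo --> x * s + y * t + z * r.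
Proof.
move=> us vt wr.
have -> : series (fun m => x * u m + y * v m + z * w m)
    = (fun n => x * series u n + y * series v n + z * series w n).
  by apply/funext => n; rewrite /series /= !big_split /= !mulr_sumr.
by apply: cvgD; [apply: cvgD|]; apply: cvgMr.
Qed.

Section Gibbs.
Variables (R : realType) (N : option nat) (w : R) (U : nat -> R) (beta a b : R).
Hypothesis w_gt0 : 0 < w.
Hypothesis hab : forall m, gibbs_support N m -> gibbs_ratio N U m = a + b * m%:R.
Variables (d : measure_display) (T : measurableType d) (Q : probability T R).
Variable Z : {RV Q >-> nat}.
Hypothesis hZ : gibbs_law N w U beta Z.

Definition mass (m : nat) : R := fine (Q (Z @^-1` [set m])).

Lemma measurable_event (A : set nat) : measurable (Z @^-1` A).
Proof. by rewrite -[X in measurable X]setTI; apply: measurable_funP. Qed.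

Lemma massE m : Q (Z @^-1` [set m]) = (mass m)%:E.
Proof. by rewrite fineK // fin_num_measure //; apply: measurable_event. Qed.

Lemma mass_ge0 m : 0 <= mass m.
Proof. by rewrite fine_ge0. Qed.

Lemma trivIset_mass (D : set nat) : trivIset D (fun m => Z @^-1` [set m]).
Proof. by move=> i j _ _ [t [/= <- <-]]. Qed.

Lemma expectation_mass (h : nat -> R) : (forall m, 0 <= h m) ->
  ('E_Q[(fun t => h (Z t))] = \sum_(m <oo) (h m * mass m)%:E)%E.
Proof.
move=> h0; rewrite unlock.
have ZT : \bigcup_m (Z @^-1` [set m]) = setT.
  by apply/seteqP; split => // t _; exists (Z t).
rewrite -ZT ge0_integral_bigcup //.
- apply: eq_eseriesr => m _; rewrite (eq_integral (cst (h m)%:E)).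
    rewrite integral_cst; last exact: measurable_event.
    by rewrite EFinM -massE.
  by move=> t; rewrite inE /= => ->.
- by move=> m; apply: measurable_event.
- rewrite ZT; apply/measurable_EFinP.
  by apply: (@measurableT_comp _ _ _ _ _ _ h).
- by move=> t _; rewrite lee_fin.
- exact: trivIset_mass.
Qed.

Lemma series_mass (h : nat -> R) (s : R) : (forall m, 0 <= h m) ->
  ('E_Q[(fun t => h (Z t))] = s%:E)%E ->
  series (fun m => h m * mass m) @ \oo --> s.
Proof.
move=> h0; rewrite expectation_mass // => hs.
have hm m : 0 <= h m * mass m by rewrite mulr_ge0 ?mass_ge0.
have cv : (fun n => \sum_(0 <= m < n) (h m * mass m)%:E)%E @ \oo --> s%:E.
  by rewrite -hs; apply: is_cvg_nneseries => m _ _; rewrite lee_fin.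
have -> : series (fun m => h m * mass m)
    = fine \o (fun n => \sum_(0 <= m < n) (h m * mass m)%:E)%E.
  by apply/funext => n; rewrite /= sumEFin.
exact: fine_cvg.
Qed.

Lemma series_mass1 : series mass @ \oo --> (1 : R).
Proof.
have -> : mass = (fun m => 1 * mass m) by apply/funext => m; rewrite mul1r.
by apply: (@series_mass (fun=> 1)) => //; exact: expectation_cst.
Qed.

Lemma mass_pair_le1 m : mass m + mass m.+1 <= 1.
Proof.
have := series_mass1 => /cvg_lim <- //.
apply: (@le_trans _ _ (series mass m.+2)).
  rewrite /series /= big_nat_recr //= big_nat_recr //= -addrA lerDr.
  by apply: sumr_ge0 => i _; apply: mass_ge0.
apply: nondecreasing_cvgn_le.
  by apply: nondecreasing_series => i _ _; apply: mass_ge0.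
by apply: cvgP series_mass1.
Qed.

Lemma weight_gt0 m : 0 < gibbs_weight w U m.
Proof. by rewrite divr_gt0 ?mulr_gt0 ?expR_gt0 ?exprn_gt0 // ltr0n fact_gt0. Qed.

Lemma support0 : gibbs_support N 0%N.
Proof. by rewrite /gibbs_support; case: N. Qed.

Lemma support_pred m : gibbs_support N m.+1 -> gibbs_support N m.
Proof. by rewrite /gibbs_support; case: N => //= N0; apply: ltnW. Qed.

Lemma beta_series :
  (\sum_(m <oo | m \in gibbs_support N) (gibbs_weight w U m)%:E = beta%:E)%E.
Proof.
rewrite nneseries_esum; last by move=> m _; rewrite lee_fin ltW ?weight_gt0.
by rewrite set_mem_set; have [->] := hZ.
Qed.

Lemma beta_gt0 : 0 < beta.
Proof.
apply: lt_le_trans (weight_gt0 0) _; rewrite -lee_fin -beta_series.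
rewrite (nneseriesD1 _ (mem_set support0)).
  rewrite leeDl // nneseries_ge0 // => m _ _.
  by rewrite lee_fin ltW ?weight_gt0.
by move=> m _; rewrite lee_fin ltW ?weight_gt0.
Qed.

Lemma mass_support m : gibbs_support N m ->
  mass m = beta^-1 * gibbs_weight w U m.
Proof. by move=> Sm; have [_ /(_ m Sm)] := hZ; rewrite massE => -[]. Qed.

Lemma mass_gt0 m : gibbs_support N m -> 0 < mass m.
Proof.
by move=> Sm; rewrite mass_support // mulr_gt0 ?invr_gt0 ?beta_gt0 ?weight_gt0.
Qed.

(** The masses on the state space already add up to one. *)
Lemma mass_out m : ~ gibbs_support N m -> mass m = 0.
Proof.
move=> Sm; set B := \bigcup_(i in gibbs_support N) (Z @^-1` [set i]).
have mB : measurable B by apply: bigcup_measurable => i _; apply: measurable_event.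
have QB : Q B = 1%E.
  rewrite measure_bigcup; [|by move=> i _; exact: measurable_event|
    exact: trivIset_mass].
  transitivity (\sum_(i <oo | i \in gibbs_support N)
                  (beta^-1%:E * (gibbs_weight w U i)%:E))%E.
    apply: eq_eseriesr => i; rewrite inE => iS.
    by rewrite -EFinM -mass_support // -massE.
  rewrite nneseriesZl; last by move=> i _; rewrite lee_fin ltW ?weight_gt0.
  by rewrite beta_series -EFinM mulVf // gt_eqF ?beta_gt0.
have QBC : Q (~` B) = 0%E by rewrite probability_setC // QB subee.
suff : ((mass m)%:E <= 0)%E.
  by rewrite lee_fin => m0; apply/eqP; rewrite eq_le mass_ge0 m0.
rewrite -QBC -massE.
apply: le_measure; rewrite ?inE; [exact: measurable_event|exact: measurableC|].
by move=> t /= Ztm [i Si Zti]; apply: Sm; rewrite -Ztm Zti.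
Qed.

(** Detailed balance between consecutive states, with birth rate [w (a + b m)]
    and death rate [m]. *)
Lemma mass_rec m : m.+1%:R * mass m.+1 = w * (a + b * m%:R) * mass m.
Proof.
have [Sm|Sm] := pselect (gibbs_support N m); last first.
  by rewrite !mass_out ?mulr0 // => /support_pred.
rewrite -hab // /gibbs_ratio; case: asboolP => Sm1; last first.
  by rewrite mass_out // !(mulr0, mul0r).
rewrite !mass_support // /gibbs_weight.
have -> : U m.+1 = U m.+1 - U m + U m by rewrite subrK.
rewrite expRD addrK factS natrM exprS.
have m0 : (m`!%:R : R) != 0 by rewrite pnatr_eq0 -lt0n fact_gt0.
have m1 : (m.+1%:R : R) != 0 by rewrite pnatr_eq0.
rewrite invfM; set x := expR _; set y := expR _.
transitivity (m.+1%:R / m.+1%:R * (beta^-1 * (x * y * (w * w ^+ m) / m`!%:R))).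
  ring.
by rewrite divff // mul1r; ring.
Qed.

Section Moments.
Variable mu : R.
Hypothesis EZ : ('E_Q[(fun t => (Z t)%:R)] = mu%:E)%E.

(** The mean and the variance come from summing the recursion, respectively its
    product with [m + 1], over all states. *)
Lemma gibbs_mean : (1 - w * b) * mu = w * a.
Proof.
have s0 := series_mass1.
have s1 : series (fun m => m%:R * mass m) @ \oo --> mu.
  exact: (@series_mass (fun m => m%:R)).
have := series_shift s1; rewrite mul0r subr0.
have -> : (fun m => m.+1%:R * mass m.+1)
    = (fun m => w * a * mass m + w * b * (m%:R * mass m) + 0 * mass m).
  by apply/funext => m; rewrite mass_rec; ring.
have lim := @series_lin _ _ _ _ (w * a) (w * b) 0 _ _ _ s0 s1 s0.
move=> shift; have muE := seq_cvg_unique shift lim.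
by rewrite mulrBl mul1r {1}muE; ring.
Qed.

Lemma gibbs_variance (v : R) : ('V_Q[(fun t => (Z t)%:R)] = v%:E)%E ->
  (1 - w * b) * v = mu.
Proof.
have s0 := series_mass1.
have s1 : series (fun m => m%:R * mass m) @ \oo --> mu.
  exact: (@series_mass (fun m => m%:R)).
rewrite /variance covariance.unlock EZ /= => VZ.
have s2 : series (fun m => (m%:R - mu) ^+ 2 * mass m) @ \oo --> v.
  apply: (@series_mass (fun m => (m%:R - mu) ^+ 2)) => [m|]; first exact: sqr_ge0.
  by rewrite -VZ; congr expectation; apply/funext => t; rewrite expr2.
have {}s2 : series (fun m => m%:R ^+ 2 * mass m) @ \oo --> v + mu ^+ 2.
  have -> : (fun m => m%:R ^+ 2 * mass m)
    = (fun m => 1 * ((m%:R - mu) ^+ 2 * mass m) + 2 * mu * (m%:R * mass m)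
                + - mu ^+ 2 * mass m).
    by apply/funext => m; ring.
  have -> : v + mu ^+ 2 = 1 * v + 2 * mu * mu + - mu ^+ 2 * 1 by ring.
  exact: series_lin.
have := series_shift s2; rewrite expr0n /= mul0r subr0.
have -> : (fun m => m.+1%:R ^+ 2 * mass m.+1)
    = (fun m => w * a * mass m + w * (a + b) * (m%:R * mass m)
                + w * b * (m%:R ^+ 2 * mass m)).
  apply/funext => m; rewrite expr2 -mulrA mass_rec -natr1; ring.
have lim := @series_lin _ _ _ _ (w * a) (w * (a + b)) (w * b) _ _ _ s0 s1 s2.
move=> shift; have s2E := seq_cvg_unique shift lim.
have mE := gibbs_mean.
have -> : (1 - w * b) * v = v + mu ^+ 2 - w * b * (v + mu ^+ 2)
    - (1 - w * b) * mu * mu by ring.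
rewrite mE {1}s2E.
transitivity (w * a + w * b * mu); first ring.
by rewrite -mE; ring.
Qed.

Hypothesis mu_gt0 : 0 < mu.

(** A law concentrated at [0] has mean zero. *)
Lemma support1 : gibbs_support N 1%N.
Proof.
apply: contrapT => S1.
have m0 m : mass m.+1 = 0.
  apply: mass_out => Sm; apply: S1; elim: m Sm => // m IH /support_pred; exact: IH.
have := @series_mass (fun m => m%:R) mu _ EZ => /(_ (fun=> ler0n _ _)).
have -> : (fun m => m%:R * mass m) = (fun=> 0).
  by apply/funext => -[|m]; rewrite ?mul0r // m0 mulr0.
have -> : series (fun=> 0 : R) = cst 0.
  by apply/funext => n; rewrite /series /= big1.
move=> lim; have mu0 := seq_cvg_unique lim (cvg_cst _).
by move: mu_gt0; rewrite mu0 ltxx.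
Qed.

Lemma a_gt0 : 0 < a.
Proof.
have := hab support0; rewrite mulr0 addr0 => <-.
by rewrite /gibbs_ratio asboolT ?expR_gt0 //; exact: support1.
Qed.

Lemma wb_lt1 : w * b < 1.
Proof.
rewrite -subr_gt0 -(pmulr_lgt0 _ mu_gt0) gibbs_mean.
by rewrite mulr_gt0 // a_gt0.
Qed.

End Moments.
End Gibbs.

(** * Solutions of the Stein equation *)

Section SteinSolution.
Variables (R : realType) (N : option nat) (w : R) (U : nat -> R) (beta a b : R).
Hypothesis w_gt0 : 0 < w.
Hypothesis hab : forall m, gibbs_support N m -> gibbs_ratio N U m = a + b * m%:R.
Variables (d : measure_display) (T : measurableType d) (Q : probability T R).
Variable Z : {RV Q >-> nat}.
Hypothesis hZ : gibbs_law N w U beta Z.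
Variable mu : R.
Hypothesis EZ : ('E_Q[(fun t => (Z t)%:R)] = mu%:E)%E.
Hypothesis mu_gt0 : 0 < mu.

Local Notation mass := (mass Z).

Definition prob_in (A : set int) : R := fine (Q ((fun t => (Z t)%:Z) @^-1` A)).

Lemma prob_inE A : Q ((fun t => (Z t)%:Z) @^-1` A) = (prob_in A)%:E.
Proof.
by rewrite fineK // fin_num_measure //; apply: (measurable_event Z (Posz @^-1` A)).
Qed.

Lemma prob_in_setC A : prob_in (~` A) = 1 - prob_in A.
Proof.
have mA : measurable ((fun t => (Z t)%:Z) @^-1` A).
  exact: (measurable_event Z (Posz @^-1` A)).
apply: EFin_inj; rewrite -prob_inE preimage_setC probability_setC //.
by rewrite EFinB -prob_inE.
Qed.

Lemma prob_in_set1 (m : nat) : prob_in [set m%:Z] = mass m.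
Proof.
rewrite /prob_in /mass; congr (fine (Q _)).
by apply/seteqP; split => t /=; [case|move=> ->].
Qed.

Lemma solutionE (A : set int) (g : int -> R) m :
  stein_solution N w U Z (\1_A) g -> gibbs_support N m ->
  w * (a + b * m%:R) * g m.+1%:Z - m%:R * g m%:Z = \1_A m%:Z - prob_in A.
Proof.
move=> [_ _ _ steq] Sm; apply: EFin_inj; rewrite -hab //.
have := steq m Sm; rewrite /stein_operator => ->.
rewrite EFinB -prob_inE; congr (_ - _)%E.
rewrite -(expectation_indic Q (measurable_event Z (Posz @^-1` A))).
by congr expectation; apply/funext => t; rewrite !indicE.
Qed.

Definition slope_le (rho : R) (g : int -> R) : Prop :=
  forall j : nat, `|g j.+1%:Z - g j%:Z| <= rho.

(** The Stein equation of the test set [{0}] at [0] reads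
    [w a g(1) = P(Z <> 0)]. *)
Lemma slope_gt0 (g : int -> R) (rho : R) :
  stein_solution N w U Z (\1_[set 0%:Z]) g -> slope_le rho g -> 0 < rho.
Proof.
move=> sol /(_ 0%N); have := solutionE sol (support0 N).
have [_ -> _ _] := sol; rewrite mulr0 addr0 mul0r !subr0 prob_in_set1 indicE.
rewrite mem_set //= => g1 /(le_trans (ler_norm _)) g1rho.
have pos := mass_gt0 w_gt0 hZ (support1 w_gt0 hZ EZ mu_gt0).
have le1 := mass_pair_le1 Z 0.
have : 0 < w * a * g 1 by rewrite g1; lra.
by rewrite pmulr_rgt0 ?mulr_gt0 ?(a_gt0 w_gt0 hab hZ EZ mu_gt0) // => /lt_le_trans; apply.
Qed.

(** Testing at the right end of a finite state space bounds the slope from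
    below; detailed balance between the last two states turns [1 - mass N0]
    into an explicit quantity. *)
Lemma slope_end (N0 : nat) (g : int -> R) (rho : R) : N = Some N0 ->
  stein_solution N w U Z (\1_[set N0%:Z]) g -> slope_le rho g ->
  1 <= rho * (N0%:R - w * b).
Proof.
move=> NE sol /(_ N0); have [_ _ out _] := sol.
have SN : gibbs_support N N0 by rewrite NE /=.
have bal : a + b * N0%:R = 0.
  rewrite -hab // /gibbs_ratio NE; case: asboolP => //=.
  by rewrite ltnn.
rewrite out => [|m]; last first.
  by rewrite NE /= => mN [] mE; move: mN; rewrite -mE ltnn.
rewrite sub0r normrN => gN.
have := solutionE sol SN; rewrite bal mulr0 mul0r sub0r prob_in_set1.
rewrite indicE mem_set //= => gE.
have [M N0E] : exists M, N0 = M.+1.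
  case: N0 NE {sol gN SN bal out gE} => [NE|M _]; last by exists M.
  by have := support1 w_gt0 hZ EZ mu_gt0; rewrite NE.
have rec := mass_rec w_gt0 hab hZ M; have le1 := mass_pair_le1 Z M.
rewrite -N0E in rec le1.
have N1 : N0%:R = M%:R + 1 :> R by rewrite N0E natr1.
have recE : N0%:R * mass N0 = - (w * b) * mass M.
  rewrite rec; have -> : a = - (b * N0%:R) by apply/eqP; rewrite -addr_eq0 bal.
  by rewrite N1; ring.
have N_gt0 : 0 < N0%:R :> R by rewrite N0E ltr0n.
have a0 := a_gt0 w_gt0 hab hZ EZ mu_gt0.
have b_lt0 : 0 < - (w * b).
  have : 0 < - b * N0%:R by move: bal a0; lra.
  by rewrite pmulr_lgt0 // -mulrN => bn; rewrite mulr_gt0.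
have Nrho : 1 - mass N0 <= N0%:R * rho.
  rewrite -gE -mulrN (ler_wpM2l (ltW N_gt0)) //.
  by apply: le_trans gN; rewrite -normrN ler_norm.
rewrite -(ler_pM2l N_gt0) mulr1 mulrA.
apply: (@le_trans _ _ ((1 - mass N0) * (N0%:R - w * b))); last first.
  by rewrite ler_wpM2r // subr_ge0; lra.
have : - (w * b) * mass M <= - (w * b) * (1 - mass N0).
  by rewrite (ler_wpM2l (ltW b_lt0)) //; lra.
rewrite -recE; lra.
Qed.

(** Beyond the right end [N0] of the state space, where the Stein equation says
    nothing but where the other variable may live, the solution is continued
    linearly with the steepest admissible negative slope. The birth rate
    [w (a + b m)] is negative there, so this makes the Stein operator large:
    the equation becomes an inequality in the useful direction. *)
Lemma extend_solution (A : set int) (g : int -> R) (rho : R) :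
  stein_solution N w U Z (\1_A) g -> slope_le rho g -> 0 <= rho ->
  (forall N0, N = Some N0 -> 1 <= rho * (N0%:R - w * b)) ->
  exists2 f : nat -> R, forall m, `|f m.+1 - f m| <= rho &
    forall m, \1_A m%:Z - prob_in A
              <= w * (a + b * m%:R) * f m.+1 - m%:R * f m.
Proof.
move=> sol slope rho0 rho_end; case NE : N => [N0|]; last first.
  exists (fun m => g m%:Z) => // m.
  have Sm : gibbs_support N m by rewrite NE.
  by rewrite -(solutionE sol Sm).
have SN m : (m <= N0)%N -> gibbs_support N m by rewrite NE.
have bal : a + b * N0%:R = 0.
  rewrite -(hab (SN _ (leqnn _))) /gibbs_ratio NE; case: asboolP => //=.
  by rewrite ltnn.
set G := g N0%:Z.
exists (fun m => if (m <= N0)%N then g m%:Z else G - rho * (m - N0)%:R).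
  move=> m; case: (ltngtP m N0) => mN; first exact: slope.
    rewrite subSn ?(ltnW mN) // -natr1.
    have -> : G - rho * ((m - N0)%:R + 1) - (G - rho * (m - N0)%:R) = - rho by ring.
    by rewrite normrN ger0_norm.
  rewrite mN subSnn /G mulr1 addrAC subrr sub0r normrN ger0_norm //.
move=> m; have [mN|mN] := ltnP N0 m; last first.
  rewrite -(solutionE sol (SN _ mN)) lerD2r; move: mN; rewrite leq_eqVlt.
  by case/orP => [/eqP ->|->//]; rewrite bal mulr0 !mul0r.
rewrite ltnNge (ltnW mN) /=.
have [i mE] : exists i, m = (N0 + i.+1)%N by exists (m - N0).-1; lia.
rewrite mE -addnS !addKn.
have G_le : G <= rho.
  have [_ _ out _] := sol; have := slope N0; rewrite out => [|l].
    by rewrite sub0r normrN => /(le_trans (ler_norm _)).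
  by rewrite NE /= => lN [] lE; move: lN; rewrite -lE ltnn.
have NG : N0%:R * G <= prob_in A.
  have := solutionE sol (SN N0 (leqnn _)); rewrite bal mulr0 mul0r sub0r -/G.
  by rewrite indicE; have : 0 <= (N0%:Z \in A)%:R :> R by []; lra.
have le1 : \1_A (N0 + i.+1)%N%:Z <= 1 :> R by rewrite indicE; case: (_ \in _).
have u0 : 0 <= - (w * b).
  have a0 := a_gt0 w_gt0 hab hZ EZ mu_gt0.
  have N_ge0 : 0 <= N0%:R :> R by [].
  rewrite -mulrN mulr_ge0 ?(ltW w_gt0) // oppr_ge0 leNgt; apply/negP => b_gt0.
  have : 0 <= b * N0%:R by apply: mulr_ge0 => //; apply: ltW.
  by move: bal a0; lra.
have rend := rho_end N0 NE.
have aE : a = - (b * N0%:R) by apply/eqP; rewrite -addr_eq0 bal.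
rewrite natrD -[i.+2%:R]natr1 -natr1 aE; set x : R := i%:R.
have x0 : 0 <= x by rewrite /x.
have N_ge0 : 0 <= N0%:R :> R by [].
have -> : w * (- (b * N0%:R) + b * (N0%:R + (x + 1))) * (G - rho * (x + 1 + 1))
    - (N0%:R + (x + 1)) * (G - rho * (x + 1))
  = - (w * b) * ((x + 1) * (rho * (x + 1) + (rho - G)))
    + (N0%:R + (x + 1)) * (rho * x + (rho - G)) by ring.
have xr : 0 <= rho * x by rewrite mulr_ge0.
have t1 : rho <= (x + 1) * (rho * (x + 1) + (rho - G)).
  have : 0 <= x * (rho * x + rho + (rho - G)) by rewrite mulr_ge0 //; lra.
  lra.
have t2 : - (w * b) * rho
    <= - (w * b) * ((x + 1) * (rho * (x + 1) + (rho - G))).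
  by rewrite ler_wpM2l.
have t3 : N0%:R * (rho - G) <= (N0%:R + (x + 1)) * (rho * x + (rho - G)).
  by apply: ler_pM => //; lra.
by move: t2 t3 rend NG le1; rewrite !mulrBr; lra.
Qed.

End SteinSolution.

(** * The total variation bound *)

Theorem theorem3p1 (R : realType)
    (k1 k2 n : nat) (hk1 : (1 <= k1)%N) (hk2 : (1 <= k2)%N)
    (hn : (5 * (k1 + k2) <= n)%N)
    (p : R) (hp0 : 0 < p) (hp1 : p < 1)
    (d : measure_display) (T : measurableType d) (P : probability T R)
    (eta : nat -> {RV P >-> bool}) (heta : bernoulli_trials n p eta)
    (N : option nat) (w : R) (hw : 0 < w) (U : nat -> R) (beta a b : R)
    (hab : forall m, gibbs_support N m -> gibbs_ratio N U m = a + b * m%:R)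
    (d' : measure_display) (T' : measurableType d') (Q : probability T' R)
    (Z : {RV Q >-> nat}) (hZ : gibbs_law N w U beta Z)
    (hmean : 'E_Q[(fun t => (Z t)%:R)]%E
             = 'E_P[(fun t => (run_count eta k1 k2 n t)%:~R)]%E)
    (g : set int -> int -> R)
    (hg : forall A : set int, stein_solution N w U Z (\1_A) (g A)) :
  let k := (k1 + k2)%N in
  let q := 1 - p in
  let ap := q ^+ k1 * p ^+ k2 in
  let phi := ('V_Q[(fun t => (Z t)%:R)]
              - 'V_P[(fun t => (run_count eta k1 k2 n t)%:~R)])%E in
  (d_TV Q P (fun t => (Z t)%:Z) (run_count eta k1 k2 n)
   <= stein_factor g
      * ((2 * (2 + q * p) * ap ^+ 2
          * (`|1 - w * b| * h1 n k p * ap + `|w * b| * h2 n k p))%:E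
         + `| phi * (1 - w * b)%:E |))%E.
Proof.
lazy zeta; set K := 2 * _ * _ * _; set phi := (_ - _)%E.
pose E := Ex (prod_weight (@trial_weight R n p)); pose W := @runs k1 k2 n.
have w0 := prod_weight_ge0 (@trial_weight_ge0 R n p hp0 hp1).
have w1 := prod_weight_sum1 (@trial_weight_sum1 R n p).
have mu_gt0 := runs_mean_gt0 hk1 hk2 hp0 hp1 hn.
have EZ := hmean; rewrite (expectation_run_count _ _ heta) in EZ.
set mu := Ex _ _ in EZ mu_gt0.
pose v := E (fun x => ((W x)%:R - mu) ^+ 2).
have VW : ('V_P[(fun t => (run_count eta k1 k2 n t)%:~R)] = v%:E)%E.
  exact: (variance_run_count k1 k2 heta).
have c_lt1 := wb_lt1 hw hab hZ EZ mu_gt0.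
have K_gt0 : 0 < K by apply: factor_gt0.
have slope_factor A j :
    (`|g A j.+1%:Z - g A j%:Z|%:E <= stein_factor g)%E.
  apply: (@le_trans _ _ (sup_delta (g A))); apply: ereal_sup_ubound.
    by exists j.
  by exists A.
have K_phi_gt0 : (0 < K%:E + `|phi * (1 - w * b)%:E|)%E.
  by apply: (@lt_le_trans _ _ K%:E); rewrite ?lte_fin ?leeDl ?abse_ge0.
have [[rho rhoE]|->] : (exists rho, stein_factor g = rho%:E) \/
    stein_factor g = +oo%E; last by rewrite gt0_mulye ?leey.
  have := slope_factor set0 0%N; case: (stein_factor g) => [r _|_|//].
    by left; exists r.
  by right.
have slope A : slope_le rho (g A) by move=> j; rewrite -lee_fin -rhoE.
have rho_gt0 := slope_gt0 hw hab hZ EZ mu_gt0 (hg _) (slope _).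
have [[vZ VZ]|VZ] : (exists vZ, 'V_Q[(fun t => (Z t)%:R)] = vZ%:E)%E \/
    'V_Q[(fun t => (Z t)%:R)]%E = +oo%E.
- have := variance_ge0 Q (fun t => (Z t)%:R).
  by case: ('V_Q[_])%E => [r _|_|//]; [left; exists r|right].
- have phiE : ((vZ - v) * (1 - w * b) = mu - (1 - w * b) * v).
    by rewrite mulrC mulrBr (gibbs_variance hw hab hZ EZ VZ).
  have meanE := gibbs_mean hw hab hZ EZ.
  have one_sided A : E (fun x => \1_A (W x)%:Z) - prob_in Z A
      <= rho * (K + `|mu - (1 - w * b) * v|).
    have [f f_rho f_stein] := extend_solution hw hab hZ EZ mu_gt0 (hg A)
      (slope A) (ltW rho_gt0)
      (fun N0 NE => slope_end hw hab hZ EZ mu_gt0 NE (hg _) (slope _)).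
    apply: le_trans (le_trans (ler_norm _)
      (runs_stein hk1 hk2 hp0 hp1 hn (w * b) f_rho)).
    rewrite -[X in _ - X](Ex_cst w1) -!ExB -!ExZ -!ExB -!ExZ -ExD.
    apply: Ex_le w0 _ _ _ => x; apply: le_trans (f_stein (W x)) _.
    rewrite -/mu -/(W x) le_eqVlt; apply/orP; left; apply/eqP.
    transitivity (w * a * f (W x).+1 + w * b * (W x)%:R * f (W x).+1
                  - (W x)%:R * f (W x)); first ring.
    by rewrite -meanE; ring.
  have -> : (`|phi * (1 - w * b)%:E| = `|mu - (1 - w * b) * v|%:E)%E.
    by rewrite /phi VZ VW -phiE.
  rewrite rhoE -EFinD -EFinM.
  apply: ge_ereal_sup => _ [A _ <-].
  rewrite prob_inE (P_run_count k1 k2 heta) -EFinB lee_fin ler_norml.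
  apply/andP; split.
    by rewrite lerNl opprB; exact: one_sided.
  have := one_sided (~` A); rewrite prob_in_setC.
  have -> : E (fun x => \1_(~` A) (W x)%:Z) = 1 - E (fun x => \1_A (W x)%:Z).
    rewrite -[X in X - _](Ex_cst w1) -ExB; apply: eq_Ex => x.
    by rewrite !indicE in_setC; case: (_ \in A); rewrite /= ?subrr ?subr0.
  by move=> bound; apply: le_trans bound; rewrite -/E le_eqVlt; apply/orP; left;
    apply/eqP; ring.
- rewrite rhoE /phi VZ VW /= gt0_mulye ?lte_fin ?subr_gt0 //=.
  by rewrite addey // gt0_muley ?lte_fin ?leey.
Qed.
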